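(* Let $R$ be an associative ring with unit, let $(\mathcal T,\mathcal S)$ be a Tor-pair over $R$ and let $m\geq 0$ be a natural number. Then: (1) the class $\mathcal T_m$ is precovering; (2) if $(\mathcal T,\mathcal S)$ is hereditary and satisfies the following equivalent conditions: (a) every module in $\mathcal S$ has $\mathrm{ML}(\mathcal T)$-projective dimension less than or equal to $1$; (b) $\mathcal T$ is closed under direct products; (c) $\mathcal T_k$ is definable for each natural number $k$; then $\mathcal T_m$ is preenveloping.
   Context: Tor-pairs: a Tor-pair over $R$ is a pair $(\mathcal T,\mathcal S)$, with $\mathcal T$ a class of right $R$-modules and $\mathcal S$ a class of left $R$-modules, such that $\mathcal T$ is the class of all right modules $M$ with $\mathrm{Tor}_1^R(M,S)=0$ for all $S\in\mathcal S$, and $\mathcal S$ is the class of all left modules $N$ with $\mathrm{Tor}_1^R(T,N)=0$ for all $T\in\mathcal T$. A class of modules is resolving if it contains all projective modules and is closed under extensions and under kernels of epimorphisms between its members. The Tor-pair is hereditary if $\mathcal T$ is resolving. Relative dimension: let $\mathcal X$ be a class of (left or right) modules containing all projective modules. For a projective resolution $\cdots\to P_1\xrightarrow{d_1}P_0\xrightarrow{d_0}M\to 0$ the $n$th syzygy is $\ker d_n$. Set $\mathcal X_0=\mathcal X$ and, for $n\ge 1$, let $\mathcal X_n$ be the class of modules $M$ having a projective resolution whose $(n-1)$st syzygy belongs to $\mathcal X$; ''$M$ has $\mathcal X$-projective dimension less than or equal to $n$'' means $M\in\mathcal X_n$. $\mathrm{ML}(\mathcal T)$ is the class of left $R$-modules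 $M$ such that for every family $\{T_i:i\in I\}$ in $\mathcal T$ the canonical map $\left(\prod_{i\in I}T_i\right)\otimes_R M\to\prod_{i\in I}(T_i\otimes_R M)$ is injective. A class of right modules is definable if it is closed under direct products, direct limits and pure submodules. Approximations: an $\mathcal X$-precover of a right module $M$ is a morphism $f:X\to M$ with $X\in\mathcal X$ such that $\mathrm{Hom}_R(X',X)\to\mathrm{Hom}_R(X',M)$ is surjective for all $X'\in\mathcal X$; dually, an $\mathcal X$-preenvelope of $M$ is a morphism $f:M\to X$ with $X\in\mathcal X$ such that $\mathrm{Hom}_R(X,X')\to\mathrm{Hom}_R(M,X')$ is surjective for all $X'\in\mathcal X$. The class $\mathcal X$ is precovering (preenveloping) if every right $R$-module has an $\mathcal X$-precover ($\mathcal X$-preenvelope). *)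

(* Defs.v *)
From HB Require Import structures.
From mathcomp Require Import all_boot all_order all_algebra.
From mathcomp Require Import boolp functions.
From mathcomp Require Import freeg.

Set Implicit Arguments.
Unset Strict Implicit.
Unset Printing Implicit Defensive.

Import Order.TTheory GRing.Theory.
Local Open Scope ring_scope.
Local Open Scope quotient_scope.

(* Left R-modules are [lmodType R]; right R-modules are left modules over the
   converse ring, with  m . r  written  (r : R^c) *: m.  [pzRingType] is an
   associative unital ring, the zero ring not being excluded.  A class of
   modules is a predicate on [lmodType R]. *)
Notation lmod R := (lmodType R) (only parsing).
Notation rmod R := (lmodType R^c) (only parsing).
Definition mclass (A : pzRingType) := lmodType A -> Prop.

Section Kernel.
Variables (A : pzRingType) (U V : lmodType A) (f : {linear U -> V}).

Definition ker_pred : {pred U} := fun x => f x == 0.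

Lemma ker_pred_submod : submod_closed ker_pred.
Proof.
split=> [|a x y]; rewrite !unfold_in; first by rewrite linear0.
by move=> /eqP fx /eqP fy; rewrite linearP fx fy scaler0 addr0.
Qed.

HB.instance Definition _ := GRing.isSubmodClosed.Build A U ker_pred
  ker_pred_submod.

Definition kermod : Type := {x : U | x \in ker_pred}.
HB.instance Definition _ := SubChoice.on kermod.
HB.instance Definition _ := [SubChoice_isSubLmodule of kermod by <:].

End Kernel.

Section DirectProduct.
Variables (A : pzRingType) (I : Type) (T : I -> lmodType A).

Definition dprod : Type := forall i, T i.
HB.instance Definition _ := Choice.on dprod.

Let zero : dprod := fun=> 0.
Let opp (x : dprod) : dprod := fun i => - x i.
Let add (x y : dprod) : dprod := fun i => x i + y i.
Let scale (a : A) (x : dprod) : dprod := fun i => a *: x i.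

Fact dprod_addA : associative add.
Proof. by move=> x y z; apply: functional_extensionality_dep => i; apply: addrA. Qed.
Fact dprod_addC : commutative add.
Proof. by move=> x y; apply: functional_extensionality_dep => i; apply: addrC. Qed.
Fact dprod_add0 : left_id zero add.
Proof. by move=> x; apply: functional_extensionality_dep => i; apply: add0r. Qed.
Fact dprod_addN : left_inverse zero opp add.
Proof. by move=> x; apply: functional_extensionality_dep => i; apply: addNr. Qed.

HB.instance Definition _ := GRing.isZmodule.Build dprod
  dprod_addA dprod_addC dprod_add0 dprod_addN.

Fact dprod_scaleA a b x : scale a (scale b x) = scale (a * b) x.
Proof. by apply: functional_extensionality_dep => i; apply: scalerA. Qed.
Fact dprod_scale1 : left_id 1 scale.
Proof. by move=> x; apply: functional_extensionality_dep => i; apply: scale1r. Qed.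
Fact dprod_scaleDr : right_distributive scale +%R.
Proof.
by move=> a x y; apply: functional_extensionality_dep => i; apply: scalerDr.
Qed.
Fact dprod_scaleDl x : {morph scale^~ x : a b / a + b}.
Proof.
by move=> a b; apply: functional_extensionality_dep => i; apply: scalerDl.
Qed.

HB.instance Definition _ := GRing.Zmodule_isLmodule.Build A dprod
  dprod_scaleA dprod_scale1 dprod_scaleDr dprod_scaleDl.

Definition dproj (i : I) (x : dprod) : T i := x i.
Fact dproj_linear i : linear (dproj i). Proof. by []. Qed.
HB.instance Definition _ i := GRing.isLinear.Build A dprod (T i) *:%R (dproj i)
  (dproj_linear i).

End DirectProduct.

(* Tensor product of a right and a left module: the free abelian group on
   M * N modulo the subgroup generated by the usual relations. *)
Section Tensor.
Variables (R : pzRingType) (M : rmod R) (N : lmod R).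
Local Notation F := {freeg (M * N)%type}.

Inductive tensor_rel : F -> Prop :=
| TensorRel0 : tensor_rel 0
| TensorRelB x y : tensor_rel x -> tensor_rel y -> tensor_rel (x - y)
| TensorRelDl m m' n :
    tensor_rel (<< (m + m', n) >> - (<< (m, n) >> + << (m', n) >>))
| TensorRelDr m n n' :
    tensor_rel (<< (m, n + n') >> - (<< (m, n) >> + << (m, n') >>))
| TensorRelZ m (r : R) n :
    tensor_rel (<< ((r : R^c) *: m, n) >> - << (m, r *: n) >>).

Definition tensor_pred : {pred F} := fun x => `[< tensor_rel x >].

Fact tensor_pred_zmod : zmod_closed tensor_pred.
Proof.
split=> [|x y]; rewrite !unfold_in; first by apply/asboolP; exact: TensorRel0.
by move=> /asboolP hx /asboolP hy; apply/asboolP; apply: TensorRelB.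
Qed.

HB.instance Definition _ := GRing.isZmodClosed.Build F tensor_pred
  tensor_pred_zmod.

Definition tensor : Type := Quotient.quot tensor_pred.
HB.instance Definition _ := GRing.Zmodule.on tensor.

Definition tens (m : M) (n : N) : tensor :=
  \pi_(Quotient.quot tensor_pred) << (m, n) >>.

Definition balanced (B : zmodType) (b : M -> N -> B) :=
  [/\ forall m m' n, b (m + m') n = b m n + b m' n,
      forall m n n', b m (n + n') = b m n + b m n' &
      forall m (r : R) n, b ((r : R^c) *: m) n = b m (r *: n)].

(* Only meaningful for a balanced [b]; otherwise it depends on the chosen
   representative. [zmodule B] is B as a Z-module. *)
Definition tens_lift (B : zmodType) (b : M -> N -> B) (x : tensor) : B :=
  fglift (fun p => b p.1 p.2 : zmodule B) (repr (x : Quotient.quot tensor_pred)).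

Section Lift.
Variables (B : zmodType) (b : M -> N -> B) (bal : balanced b).
Let L (x : F) : B := fglift (fun p => b p.1 p.2 : zmodule B) x.

Let LB x y : L (x - y) = L x - L y.
Proof. exact: (@lift_is_additive _ _ _ (fun p => b p.1 p.2 : zmodule B)). Qed.
Let LU p : L << p >> = b p.1 p.2.
Proof. by rewrite /L liftU scale1r. Qed.
Let Lz : L 0 = 0.
Proof. by rewrite -[X in L X](subrr 0) LB subrr. Qed.
Let LD x y : L (x + y) = L x + L y.
Proof. by rewrite -[in LHS](opprK y) LB -(sub0r y) LB Lz sub0r opprK. Qed.
Let L_rel x : tensor_rel x -> L x = 0.
Proof.
case: bal => bDl bDr bZ.
elim=> {x} [|x y _ hx _ hy|m m' n|m n n'|m r n]; first exact: Lz.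
- by rewrite LB hx hy subr0.
- by rewrite LB LD !LU bDl subrr.
- by rewrite LB LD !LU bDr subrr.
- by rewrite LB !LU bZ subrr.
Qed.

Let L_pi (x : F) : tens_lift b (\pi_(Quotient.quot tensor_pred) x) = L x.
Proof.
apply/eqP; rewrite -subr_eq0 -LB; apply/eqP/L_rel/asboolP.
by rewrite -[`[< _ >]]/(_ \in tensor_pred) Quotient.idealrBE reprK.
Qed.

Lemma tens_lift_tens m n : tens_lift b (tens m n) = b m n.
Proof. by rewrite L_pi LU. Qed.

Lemma tens_lift_additive : zmod_morphism (tens_lift b).
Proof.
move=> x y; rewrite -[x](@reprK _ (Quotient.quot tensor_pred)).
rewrite -[y](@reprK _ (Quotient.quot tensor_pred)).
by rewrite -[X in tens_lift b X](raddfB (\pi_(Quotient.quot tensor_pred))) !L_pi LB.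
Qed.
End Lift.

End Tensor.

Lemma tens_balanced (R : pzRingType) (M : rmod R) (N : lmod R) :
  balanced (@tens R M N).
Proof.
split=> [m m' n|m n n'|m r n]; apply/eqP; rewrite /tens.
- rewrite -[X in _ == X](raddfD (\pi_(Quotient.quot _))) -Quotient.idealrBE.
  by apply/asboolP; apply: TensorRelDl.
- rewrite -[X in _ == X](raddfD (\pi_(Quotient.quot _))) -Quotient.idealrBE.
  by apply/asboolP; apply: TensorRelDr.
- by rewrite -Quotient.idealrBE; apply/asboolP; apply: TensorRelZ.
Qed.

(* f (x) N *)
Definition tensmap (R : pzRingType) (M M' : rmod R) (f : {linear M -> M'})
    (N : lmod R) : tensor M N -> tensor M' N :=
  tens_lift (fun m n => tens (f m) n).

Lemma tensmap_balanced (R : pzRingType) (M M' : rmod R)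
    (f : {linear M -> M'}) (N : lmod R) :
  balanced (fun m (n : N) => tens (f m) n).
Proof.
have [hDl hDr hZ] := @tens_balanced R M' N.
by split=> *; rewrite ?linearD ?linearZ ?hDl ?hDr ?hZ.
Qed.

Lemma tensmap_tens (R : pzRingType) (M M' : rmod R)
    (f : {linear M -> M'}) (N : lmod R) m n :
  tensmap f (tens m n : tensor M N) = tens (f m) n.
Proof. exact: (tens_lift_tens (tensmap_balanced f N)). Qed.

Lemma tensmap_additive (R : pzRingType) (M M' : rmod R)
    (f : {linear M -> M'}) (N : lmod R) :
  zmod_morphism (@tensmap R M M' f N).
Proof. exact: (tens_lift_additive (tensmap_balanced f N)). Qed.

Section HomologicalNotions.
Variable A : pzRingType.

Definition surj (X Y : Type) (f : X -> Y) := forall y, exists x, f x = y.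

Definition exact_at (K M N : lmodType A)
    (f : {linear K -> M}) (g : {linear M -> N}) :=
  forall y, g y = 0 <-> exists x, f x = y.

Definition short_exact (K M N : lmodType A)
    (f : {linear K -> M}) (g : {linear M -> N}) :=
  [/\ injective f, exact_at f g & surj g].

Definition projective (P : lmodType A) :=
  forall (X Y : lmodType A) (g : {linear X -> Y}) (f : {linear P -> Y}),
    surj g -> exists h : {linear P -> X}, forall x, g (h x) = f x.

(* The differential d_n of the resolution is [res_d0] for n = 0 and
   [res_dS n'] for n = n'.+1. *)
Record proj_resolution (M : lmodType A) := ProjResolution {
  res_P : nat -> lmodType A;
  res_d0 : {linear res_P 0 -> M};
  res_dS : forall n, {linear res_P n.+1 -> res_P n};
  res_projective : forall n, projective (res_P n);
  res_surj : surj res_d0;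
  res_exact0 : exact_at (res_dS 0) res_d0;
  res_exactS : forall n, exact_at (res_dS n.+1) (res_dS n)
}.

Definition syzygy (M : lmodType A) (P : proj_resolution M) (n : nat) :
    lmodType A :=
  if n is n'.+1 then kermod (res_dS P n') else kermod (res_d0 P).

(* [rel_dim X n M]: M has X-projective dimension at most n. *)
Definition rel_dim (X : mclass A) (n : nat) : mclass A := fun M =>
  if n is n'.+1 then exists P : proj_resolution M, X (syzygy P n') else X M.

Definition resolving (X : mclass A) :=
  [/\ forall P, projective P -> X P,
      forall (K M N : lmodType A) (f : {linear K -> M}) (g : {linear M -> N}),
        short_exact f g -> X K -> X N -> X M &
      forall (K M N : lmodType A) (f : {linear K -> M}) (g : {linear M -> N}),
        short_exact f g -> X M -> X N -> X K].

Definition closed_products (X : mclass A) :=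
  forall (I : Type) (T : I -> lmodType A),
    (forall i, X (T i)) -> X (dprod T).

Record direct_system (d : Order.disp_t) (I : porderType d) := DirectSystem {
  ds_obj : I -> lmodType A;
  ds_mor : forall i j, (i <= j)%O -> {linear ds_obj i -> ds_obj j};
  ds_nonempty : inhabited I;
  ds_directed : forall i j : I, exists k, (i <= k)%O /\ (j <= k)%O;
  ds_id : forall i (le_ii : (i <= i)%O) x, ds_mor le_ii x = x;
  ds_comp : forall i j k (le_ij : (i <= j)%O) (le_jk : (j <= k)%O)
      (le_ik : (i <= k)%O) x,
    ds_mor le_jk (ds_mor le_ij x) = ds_mor le_ik x
}.

Definition cocone (d : Order.disp_t) (I : porderType d)
    (D : direct_system I) (C : lmodType A)
    (c : forall i, {linear ds_obj D i -> C}) :=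
  forall i j (le_ij : (i <= j)%O) x, c j (ds_mor D le_ij x) = c i x.

Definition is_direct_limit (d : Order.disp_t) (I : porderType d)
    (D : direct_system I) (L : lmodType A)
    (l : forall i, {linear ds_obj D i -> L}) :=
  cocone l /\
  forall (C : lmodType A) (c : forall i, {linear ds_obj D i -> C}), cocone c ->
    exists2 u : {linear L -> C}, forall i x, u (l i x) = c i x &
      forall v : {linear L -> C}, (forall i x, v (l i x) = c i x) -> v =1 u.

Definition closed_direct_limits (X : mclass A) :=
  forall (d : Order.disp_t) (I : porderType d) (D : direct_system I)
      (L : lmodType A) (l : forall i, {linear ds_obj D i -> L}),
    is_direct_limit l -> (forall i, X (ds_obj D i)) -> X L.

Definition is_precover (X : mclass A) (M Y : lmodType A)
    (f : {linear Y -> M}) :=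
  X Y /\ forall (Y' : lmodType A) (h : {linear Y' -> M}), X Y' ->
    exists g : {linear Y' -> Y}, forall y, f (g y) = h y.

Definition is_preenvelope (X : mclass A) (M Y : lmodType A)
    (f : {linear M -> Y}) :=
  X Y /\ forall (Y' : lmodType A) (h : {linear M -> Y'}), X Y' ->
    exists g : {linear Y -> Y'}, forall x, g (f x) = h x.

Definition precovering (X : mclass A) :=
  forall M : lmodType A, exists (Y : lmodType A) (f : {linear Y -> M}), is_precover X f.

Definition preenveloping (X : mclass A) :=
  forall M : lmodType A, exists (Y : lmodType A) (f : {linear M -> Y}), is_preenvelope X f.

End HomologicalNotions.

(* Every module has a projective resolution, so that the quantification over
   resolutions in [Tor1_zero] below is not vacuous. *)
Section FreeModule.
Variables (A : pzRingType) (X : choiceType).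

Definition fin_supp : {pred X -> A^o} :=
  fun f => `[< exists s : seq X, forall x, f x != 0 -> x \in s >].

Fact fin_supp_submod : submod_closed fin_supp.
Proof.
split=> [|a f g]; rewrite !unfold_in.
  by apply/asboolP; exists [::] => x; rewrite eqxx.
move=> /asboolP[s hs] /asboolP[t ht]; apply/asboolP; exists (s ++ t) => x.
rewrite mem_cat; apply: contraNT; rewrite negb_or => /andP[xs xt].
have /eqP fx : f x == 0 by apply: contraNT xs => /hs.
have /eqP gx : g x == 0 by apply: contraNT xt => /ht.
by rewrite /= [X in X == _](_ : _ = a * f x + g x) // fx gx mulr0 addr0.
Qed.

HB.instance Definition _ := GRing.isSubmodClosed.Build A (X -> A^o) fin_supp
  fin_supp_submod.

Definition freemod : Type := {f : X -> A^o | f \in fin_supp}.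
HB.instance Definition _ := SubChoice.on freemod.
HB.instance Definition _ := [SubChoice_isSubLmodule of freemod by <:].

Definition coef (f : freemod) (x : X) : A := val f x.
Lemma supp_exists (f : freemod) : exists s : seq X, uniq s /\ forall x, coef f x != 0 -> x \in s.
Proof.
have /asboolP[s hs] := valP f; exists (undup s); split; first exact: undup_uniq.
by move=> x /hs; rewrite mem_undup.
Qed.

Definition supp f := projT1 (cid (supp_exists f)).

Variables (M : lmodType A) (h : X -> M).
Definition fsum (f : freemod) : M := \sum_(x <- supp f) coef f x *: h x.

Lemma fsumE f s : uniq s -> (forall x, coef f x != 0 -> x \in s) ->
  fsum f = \sum_(x <- s) coef f x *: h x.
Proof.
rewrite /fsum /supp; case: cid => t [/= ut ht] us hs.
have H r : uniq r -> (forall x, coef f x != 0 -> x \in r) ->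
   \sum_(x <- r) coef f x *: h x = \sum_(x <- [seq x <- r | coef f x != 0]) coef f x *: h x.
  move=> ur hr; rewrite big_filter [LHS](bigID (fun x => coef f x != 0)) /=.
  by rewrite [X in _ + X]big1 ?addr0 // => i /negPn/eqP->; rewrite scale0r.
rewrite (H t) // (H s) //; apply: perm_big; apply: uniq_perm; rewrite ?filter_uniq //.
by move=> x; rewrite !mem_filter; case: (boolP (coef f x != 0)) => //= nz; rewrite ht ?hs.
Qed.

Lemma fsum_linear : linear fsum.
Proof.
move=> a f g.
have [s [us hs]] := supp_exists f; have [t [ut ht]] := supp_exists g.
have hu : uniq (undup (s ++ t)) := undup_uniq _.
have hf x : coef f x != 0 -> x \in undup (s ++ t).
  by move=> /hs xs; rewrite mem_undup mem_cat xs.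
have hg x : coef g x != 0 -> x \in undup (s ++ t).
  by move=> /ht xs; rewrite mem_undup mem_cat xs orbT.
rewrite (fsumE hu hf) (fsumE hu hg) (@fsumE _ (undup (s ++ t))) //.
  rewrite scaler_sumr -big_split /=; apply: eq_bigr => x _.
  by rewrite scalerA -scalerDl.
move=> x; apply: contraNT => nx.
have /eqP fx : coef f x == 0 by apply: contraNT nx => /hf.
have /eqP gx : coef g x == 0 by apply: contraNT nx => /hg.
by rewrite [X in X == _](_ : _ = a * coef f x + coef g x) // fx gx mulr0 addr0.
Qed.
HB.instance Definition _ := GRing.isLinear.Build A freemod M *:%R fsum fsum_linear.
End FreeModule.

Section FreeModuleTheory.
Variables (A : pzRingType) (X : choiceType).
Lemma delta_fin (x : X) : (fun y => (y == x)%:R : A^o) \in @fin_supp A X.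
Proof.
apply/asboolP; exists [:: x] => y; rewrite inE.
by apply: contraNT => /negPf->.
Qed.
Definition delta x : freemod A X := exist (fun f => f \in @fin_supp A X) _ (delta_fin x).
Lemma fsum_delta (M : lmodType A) (h : X -> M) x : fsum h (delta x) = h x.
Proof.
rewrite (@fsumE _ _ _ _ _ [:: x]) //.
  by rewrite big_seq1 /coef /= eqxx scale1r.
by move=> y; rewrite /coef /= inE; apply: contraNT => /negPf->.
Qed.

Lemma freemodE (f : freemod A X) s : uniq s -> (forall x, coef f x != 0 -> x \in s) ->
  f = \sum_(x <- s) coef f x *: delta x.
Proof.
move=> us hs; apply: val_inj; rewrite raddf_sum; apply: funext => y.
rewrite fct_sumE /=.
have [ys|nys] := boolP (y \in s).
  rewrite (bigD1_seq y) //= big1 ?addr0 => [|x /negPf nxy].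
    by rewrite /= [RHS](_ : _ = coef f y * (y == y)%:R) // eqxx mulr1.
  by rewrite [LHS](_ : _ = coef f x * (y == x)%:R) // eq_sym nxy mulr0.
rewrite big_seq big1.
  by apply/eqP; apply: contraNT nys => /hs.
move=> x xs; rewrite [LHS](_ : _ = coef f x * (y == x)%:R) //.
by case: eqP xs nys => [<- ->//|]; rewrite mulr0.
Qed.

Lemma freemod_projective : projective (freemod A X).
Proof.
move=> U V g f sg.
have hP x : exists u, g u = f (delta x) := sg _.
pose h x := projT1 (cid (hP x)).
have hE x : g (h x) = f (delta x) by rewrite /h; case: cid.
exists (fsum h) => z.
have [s [us hs]] := supp_exists z.
change (g (fsum h z) = f z).
rewrite (@fsumE _ _ _ h z s us hs) [in RHS](freemodE us hs) !linear_sum.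
by apply: eq_bigr => x _; rewrite !linearZ /= hE.
Qed.
End FreeModuleTheory.

Section FreeResolution.
Variables (A : pzRingType).
Fixpoint free_syz (M : lmodType A) n : lmodType A :=
  if n is n'.+1 then kermod (@fsum A (free_syz M n') (free_syz M n') id) else M.
Definition free_d M n : freemod A (free_syz M n.+1) -> freemod A (free_syz M n) :=
   val \o (@fsum A (free_syz M n.+1) (free_syz M n.+1) id).
Lemma free_d_linear M n : linear (@free_d M n).
Proof. by move=> a x y; rewrite /free_d /= !linearP. Qed.
HB.instance Definition _ M n := GRing.isLinear.Build A _ _ *:%R (@free_d M n) (@free_d_linear M n).

Lemma fsum_surj (M : lmodType A) : surj (@fsum A M M id).
Proof. by move=> y; exists (delta A y); rewrite fsum_delta. Qed.

Lemma proj_resolution_exists (M : lmodType A) : inhabited (proj_resolution M).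
Proof.
constructor.
refine (@ProjResolution A M (fun n => freemod A (free_syz M n)) (@fsum A M M id)
 (fun n => @free_d M n) _ _ _ _).
- by move=> n; apply: freemod_projective.
- exact: fsum_surj.
- move=> y; split => [y0|[x <-]].
    have yk : y \in ker_pred (@fsum A M M id) by apply/eqP.
    have [x hx] := @fsum_surj (free_syz M 1) (exist (fun z => z \in ker_pred _) y yk).
    by exists x; rewrite /= /free_d /= hx.
  by rewrite /free_d /=; apply/eqP; exact: (valP (fsum id x : free_syz M 1)).
- move=> n y; split => [y0|[x <-]].
    have yk : y \in ker_pred (@fsum A (free_syz M n.+1) (free_syz M n.+1) id).
      by apply/eqP; apply: val_inj; rewrite [LHS]y0 raddf0.
    have [x hx] := @fsum_surj (free_syz M n.+2) (exist (fun z => z \in ker_pred _) y yk).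
    by exists x; rewrite /= /free_d /= hx.
  rewrite /= /free_d /=.
  have /eqP -> := valP (fsum id x : free_syz M n.+2).
  by [].
Qed.
End FreeResolution.

Section TorPairs.
Variable R : pzRingType.

(* Tor_1(M, N) = 0: for a projective resolution P of M, the complex
   P (x) N has no homology in degree 1.  This does not depend on P. *)
Definition Tor1_zero (M : rmod R) (N : lmod R) :=
  forall (P : proj_resolution M) (z : tensor (res_P P 1) N),
    tensmap (res_dS P 0) z = 0 ->
    exists w : tensor (res_P P 2) N, tensmap (res_dS P 1) w = z.

Definition tor_pair (T : mclass R^c) (S : mclass R) :=
  (forall M, T M <-> forall N, S N -> Tor1_zero M N) /\
  (forall N, S N <-> forall M, T M -> Tor1_zero M N).

Definition hereditary (T : mclass R^c) (S : mclass R) := resolving T.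

Definition ML_map (I : Type) (T : I -> rmod R) (M : lmod R)
    (x : tensor (dprod T) M) : forall i, tensor (T i) M :=
  fun i => tensmap (@dproj _ _ T i) x.

Definition ML (T : mclass R^c) : mclass R := fun M =>
  forall (I : Type) (Ti : I -> rmod R), (forall i, T (Ti i)) ->
    injective (@ML_map I Ti M).

Definition pure_mono (N M : rmod R) (f : {linear N -> M}) :=
  injective f /\ forall L : lmod R, injective (@tensmap R N M f L).

Definition closed_pure_submodules (X : mclass R^c) :=
  forall (N M : rmod R) (f : {linear N -> M}), pure_mono f -> X M -> X N.

Definition definable (X : mclass R^c) :=
  [/\ closed_products X, closed_direct_limits X & closed_pure_submodules X].

End TorPairs.

(* Main.v *)
(* By dimension shifting in both variables, M lies in T_m iff Tor_1(M, N') = 0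
   for every m-th syzygy N' of a module of S; hence T_m is closed under direct
   sums, direct limits, pure submodules and pure quotients.

   Precovers: given f : V -> M, let P be maximal among the pure submodules of V
   below ker f.  Then f factors through the pure quotient V / P, whose size is
   bounded in terms of M alone (Bican, El Bashir, Enochs), so that the direct
   sum of all small modules of T_m over M is a precover.  Preenvelopes: the
   image of M -> V lies in a small pure submodule of V, so when T_m is closed under
   products the product of all small modules of T_m under M is a preenvelope.

   For (a) <-> (b) one compares the product of the T_i (x) K -> T_i (x) P with
   (prod T_i) (x) K -> (prod T_i) (x) P for a projective presentation
   0 -> K -> P -> N -> 0, using that projective modules are Mittag-Leffler.
   For (b) -> (c), a product of projective presentations is a presentation by a
   module of T, and modules of T have no higher Tor with S. *)

From HB Require Import structures.
From mathcomp Require Import all_boot all_order all_algebra.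
From mathcomp Require Import boolp classical_sets functions.
From mathcomp Require Import freeg.
Require Import Defs.

Set Implicit Arguments.
Unset Strict Implicit.
Unset Printing Implicit Defensive.

Import Order.POrderTheory GRing.Theory.
Local Open Scope ring_scope.
Local Open Scope quotient_scope.

(** * Linear maps and quotient modules *)

Section LinearMaps.
Variable A : pzRingType.

Section Pack.
Variables (U V : lmodType A) (f : U -> V) (fL : linear f).
Definition linear_fun := f.
HB.instance Definition _ := GRing.isLinear.Build A U V *:%R linear_fun fL.
Definition Lin : {linear U -> V} := linear_fun.
Lemma LinE x : Lin x = f x. Proof. by []. Qed.
End Pack.

Lemma factor_surj (U V W : lmodType A) (p : {linear U -> V})
    (f : {linear U -> W}) : surj p -> (forall x, p x = 0 -> f x = 0) ->
  exists g : {linear V -> W}, forall x, g (p x) = f x.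
Proof.
move=> ps pf; pose s y := projT1 (cid (ps y)).
have sK y : p (s y) = y by rewrite /s; case: cid.
have fp x y : p x = p y -> f x = f y.
  by move=> e; apply/eqP; rewrite -subr_eq0 -linearB pf // linearB e subrr.
have gL : linear (f \o s).
  by move=> a x y /=; rewrite -linearP; apply: fp; rewrite linearP !sK.
by exists (Lin gL) => x; apply: fp; rewrite sK.
Qed.

Lemma factor_inj (U V W : lmodType A) (i : {linear V -> W})
    (f : {linear U -> W}) : injective i -> (forall x, exists y, i y = f x) ->
  exists g : {linear U -> V}, forall x, i (g x) = f x.
Proof.
move=> inji fi; pose s x := projT1 (cid (fi x)).
have sK x : i (s x) = f x by rewrite /s; case: cid.
have gL : linear s by move=> a x y; apply: inji; rewrite linearP !sK linearP.
by exists (Lin gL).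
Qed.

Lemma ker_val_eq0 (U V : lmodType A) (f : {linear U -> V}) (x : kermod f) :
  f (val x) = 0.
Proof. by apply/eqP; exact: (valP x). Qed.

Lemma ker_lift (U V : lmodType A) (f : {linear U -> V}) (x : U) :
  f x = 0 -> exists y : kermod f, val y = x.
Proof. by move=> fx; exists (exist _ x (introT eqP fx)). Qed.

End LinearMaps.

Section Quotient.
Variables (A : pzRingType) (V : lmodType A) (U : {pred V}).
Variable Usub : submod_closed U.

Definition quo_pred : {pred V} := U.
HB.instance Definition _ := GRing.isSubmodClosed.Build A V quo_pred Usub.

Definition quomod : Type := Quotient.quot quo_pred.
HB.instance Definition _ := GRing.Zmodule.on quomod.

Let cls (x : V) : quomod := \pi_(Quotient.quot quo_pred) x.
Let clsP x y : x - y \in quo_pred -> cls x = cls y.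
Proof. by rewrite Quotient.idealrBE => /eqP. Qed.
Let clsB x y : cls (x - y) = cls x - cls y.
Proof. exact: (raddfB (\pi_(Quotient.quot quo_pred))). Qed.
Let clsD x y : cls (x + y) = cls x + cls y.
Proof. exact: (raddfD (\pi_(Quotient.quot quo_pred))). Qed.
Let cls0 x : cls x = 0 -> x \in quo_pred.
Proof.
by move=> h; rewrite -[x]subr0 Quotient.idealrBE; apply/eqP; rewrite raddf0.
Qed.
Let rep (x : quomod) : V := repr (x : Quotient.quot quo_pred).
Let repK x : cls (rep x) = x. Proof. exact: reprK. Qed.
Let scale (a : A) (x : quomod) : quomod := cls (a *: rep x).

Let scale_cls a x : scale a (cls x) = cls (a *: x).
Proof.
apply: clsP; rewrite -scalerBr; apply: rpredZ; apply: cls0.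
by rewrite clsB repK subrr.
Qed.

Fact quomod_scaleA a b x : scale a (scale b x) = scale (a * b) x.
Proof. by rewrite -[x]repK !scale_cls scalerA. Qed.
Fact quomod_scale1 : left_id 1 scale.
Proof. by move=> x; rewrite -[x]repK !scale_cls scale1r. Qed.
Fact quomod_scaleDr : right_distributive scale +%R.
Proof. by move=> a x y; rewrite -[x]repK -[y]repK -clsD !scale_cls scalerDr clsD. Qed.
Fact quomod_scaleDl x : {morph scale^~ x : a b / a + b}.
Proof. by move=> a b; rewrite -[x]repK !scale_cls scalerDl clsD. Qed.

HB.instance Definition _ := GRing.Zmodule_isLmodule.Build A quomod
  quomod_scaleA quomod_scale1 quomod_scaleDr quomod_scaleDl.

Fact quo_proj_linear : linear cls.
Proof. by move=> a x y; rewrite clsD -scale_cls. Qed.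
Definition quo_proj : {linear V -> quomod} := Lin quo_proj_linear.

Lemma quo_proj_surj : surj quo_proj.
Proof. by move=> y; exists (rep y); rewrite LinE repK. Qed.

Lemma quo_proj_eq0 x : quo_proj x = 0 <-> x \in U.
Proof.
rewrite LinE; split=> [|xU]; first exact: cls0.
by rewrite (@clsP x 0) ?subr0 // -[0 in LHS](subrr 0) clsB subrr.
Qed.
End Quotient.

(** * Tensor products *)

Section AdditiveMaps.

Section Pack.
Variables (U V : zmodType) (f : U -> V) (fA : zmod_morphism f).
Definition additive_fun := f.
HB.instance Definition _ := GRing.isZmodMorphism.Build U V additive_fun fA.
Definition Add : {additive U -> V} := additive_fun.
End Pack.

Section Cokernel.
Variables (U V : zmodType) (f : {additive U -> V}).
Definition img_pred : {pred V} := fun y => `[< exists x, f x = y >].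
Fact img_pred_zmod : zmod_closed img_pred.
Proof.
split=> [|x y]; rewrite !unfold_in; first by apply/asboolP; exists 0; rewrite raddf0.
move=> /asboolP[u <-] /asboolP[v <-]; apply/asboolP.
by exists (u - v); rewrite raddfB.
Qed.
HB.instance Definition _ := GRing.isZmodClosed.Build V img_pred img_pred_zmod.

(** Serves right exactness of the tensor product: membership in the range of [f] becomes vanishing
    under [q]. *)
Lemma cokernel_exists : exists (Q : zmodType) (q : {additive V -> Q}),
  forall y, q y = 0 <-> exists x, f x = y.
Proof.
exists (Quotient.quot img_pred).
have qA : zmod_morphism (fun x => \pi_(Quotient.quot img_pred) x).
  by move=> x y; exact: (raddfB (\pi_(Quotient.quot img_pred))).
exists (Add qA) => y.
suff -> : Add qA y = 0 <-> y \in img_pred by split=> /asboolP.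
rewrite -[X in X \in _]subr0 Quotient.idealrBE raddf0.
by split => [/eqP|/eqP].
Qed.
End Cokernel.
End AdditiveMaps.

Arguments tensmap {R M M'} f {N} x.

Section TensorTheory.
Variable R : pzRingType.
Implicit Types (M : rmod R) (N : lmod R).

HB.instance Definition _ M M' (f : {linear M -> M'}) N :=
  GRing.isZmodMorphism.Build _ _ (@tensmap R M M' f N)
    (@tensmap_additive R M M' f N).

Lemma tensDl M N (m m' : M) (n : N) : tens (m + m') n = tens m n + tens m' n.
Proof. by case: (tens_balanced M N). Qed.
Lemma tensDr M N (m : M) (n n' : N) : tens m (n + n') = tens m n + tens m n'.
Proof. by case: (tens_balanced M N). Qed.
Lemma tensZ M N (m : M) (r : R) (n : N) : tens ((r : R^c) *: m) n = tens m (r *: n).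
Proof. by case: (tens_balanced M N). Qed.

Fact tensl_additive M N (n : N) : zmod_morphism (fun m : M => tens m n).
Proof.
move=> x y; apply: (@addIr _ (tens y n)).
by rewrite -tensDl subrK addrNK.
Qed.
Definition tensl M N (n : N) : {additive M -> tensor M N} := Add (tensl_additive n).
Fact tensr_additive M N (m : M) : zmod_morphism (fun n : N => tens m n).
Proof.
move=> x y; apply: (@addIr _ (tens m y)).
by rewrite -tensDr subrK addrNK.
Qed.
Definition tensr M N (m : M) : {additive N -> tensor M N} := Add (@tensr_additive M N m).

Lemma tens0l M N (n : N) : tens (0 : M) n = 0.
Proof. exact: (raddf0 (tensl M n)). Qed.
Lemma tens0r M N (m : M) : tens m (0 : N) = 0.
Proof. exact: (raddf0 (tensr N m)). Qed.
Lemma tensBl M N (m m' : M) (n : N) : tens (m - m') n = tens m n - tens m' n.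
Proof. exact: (raddfB (tensl M n)). Qed.
Lemma tensBr M N (m : M) (n n' : N) : tens m (n - n') = tens m n - tens m n'.
Proof. exact: (raddfB (tensr N m)). Qed.
Lemma tens_suml M N (I : Type) (s : seq I) (F : I -> M) (n : N) :
  tens (\sum_(i <- s) F i) n = \sum_(i <- s) tens (F i) n.
Proof. exact: (raddf_sum (tensl M n)). Qed.
Lemma tens_sumr M N (I : Type) (s : seq I) (F : I -> N) (m : M) :
  tens m (\sum_(i <- s) F i) = \sum_(i <- s) tens m (F i).
Proof. exact: (raddf_sum (tensr N m)). Qed.

Lemma tens_spanned M N (z : tensor M N) :
  exists l : seq (M * N), z = \sum_(p <- l) tens p.1 p.2.
Proof.
rewrite -[z](@reprK _ (Quotient.quot (@tensor_pred R M N))).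
move: (repr _) => D; rewrite -(freeg_sumE D) raddf_sum.
elim: (dom D) => [|[m n] d [l IH]]; first by exists [::]; rewrite !big_nil.
(* The integer coefficient is absorbed into the first factor. *)
exists ((m *~ coeff (m, n) D, n) :: l); rewrite !big_cons -IH; congr (_ + _).
rewrite -[LHS]/(\pi_(Quotient.quot (@tensor_pred R M N)) _).
rewrite (_ : << _ *g _ >> = << (m, n) >> *~ coeff (m, n) D).
  rewrite (raddfMz (\pi_(Quotient.quot (@tensor_pred R M N)))).
  exact: esym (raddfMz (tensl M n) _ _).
by rewrite freegU_mulz intz.
Qed.

Lemma tens_ext M N (B : zmodType) (f g : {additive tensor M N -> B}) :
  (forall m n, f (tens m n) = g (tens m n)) -> forall z, f z = g z.
Proof.
move=> fg z; have [l ->] := tens_spanned z.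
by rewrite !raddf_sum; apply: eq_bigr => p _; apply: fg.
Qed.

Lemma tens_universal M N (B : zmodType) (b : M -> N -> B) : balanced b ->
  exists f : {additive tensor M N -> B}, forall m n, f (tens m n) = b m n.
Proof.
by move=> bb; exists (Add (tens_lift_additive bb)) => m n; exact: tens_lift_tens.
Qed.

Definition tensmapr M N N' (g : {linear N -> N'}) : tensor M N -> tensor M N' :=
  tens_lift (fun m n => tens m (g n)).

Arguments tensmapr {M N N'} g x.

Lemma tensmapr_balanced M N N' (g : {linear N -> N'}) :
  balanced (fun (m : M) n => tens m (g n)).
Proof.
by split=> *; rewrite ?linearD ?linearZ ?tensDl ?tensDr ?tensZ.
Qed.

Lemma tensmapr_tens M N N' (g : {linear N -> N'}) (m : M) n :
  tensmapr g (tens m n) = tens m (g n).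
Proof. exact: (tens_lift_tens (tensmapr_balanced M g)). Qed.

HB.instance Definition _ M N N' (g : {linear N -> N'}) :=
  GRing.isZmodMorphism.Build _ _ (@tensmapr M N N' g)
    (tens_lift_additive (tensmapr_balanced M g)).

Lemma tensmapC M M' (f : {linear M -> M'}) N N' (g : {linear N -> N'}) z :
  tensmap f (tensmapr g z) = tensmapr g (tensmap f z).
Proof.
apply: (tens_ext (f := tensmap f \o tensmapr g) (g := tensmapr g \o tensmap f)).
by move=> m n /=; rewrite !(tensmap_tens, tensmapr_tens).
Qed.

Lemma tensmap_comp M M' M'' (f : {linear M -> M'}) (g : {linear M' -> M''})
    (h : {linear M -> M''}) N (z : tensor M N) :
  (forall x, g (f x) = h x) -> tensmap g (tensmap f z) = tensmap h z.
Proof.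
move=> gf; apply: (tens_ext (f := tensmap g \o tensmap f) (g := tensmap h)).
by move=> m n /=; rewrite !tensmap_tens gf.
Qed.

Lemma tensmapr_comp M N N' N'' (f : {linear N -> N'}) (g : {linear N' -> N''})
    (h : {linear N -> N''}) (z : tensor M N) :
  (forall x, g (f x) = h x) -> tensmapr g (tensmapr f z) = tensmapr h z.
Proof.
move=> gf; apply: (tens_ext (f := tensmapr g \o tensmapr f) (g := tensmapr h)).
by move=> m n /=; rewrite !tensmapr_tens gf.
Qed.

Lemma tensmap_id M (f : {linear M -> M}) N (z : tensor M N) :
  (forall x, f x = x) -> tensmap f z = z.
Proof.
move=> fE; apply: (tens_ext (f := tensmap f) (g := idfun)) => m n /=.
by rewrite tensmap_tens fE.
Qed.

Lemma tensmapr_id M N (f : {linear N -> N}) (z : tensor M N) :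
  (forall x, f x = x) -> tensmapr f z = z.
Proof.
move=> fE; apply: (tens_ext (f := tensmapr f) (g := idfun)) => m n /=.
by rewrite tensmapr_tens fE.
Qed.

Lemma tensmap0 M M' (f : {linear M -> M'}) N (z : tensor M N) :
  (forall x, f x = 0) -> tensmap f z = 0.
Proof.
move=> f0; apply: (tens_ext (f := tensmap f) (g := \0)) => m n /=.
by rewrite tensmap_tens f0 tens0l.
Qed.

Lemma tensmapr0 M N N' (f : {linear N -> N'}) (z : tensor M N) :
  (forall x, f x = 0) -> tensmapr f z = 0.
Proof.
move=> f0; apply: (tens_ext (f := tensmapr f) (g := \0)) => m n /=.
by rewrite tensmapr_tens f0 tens0r.
Qed.

Lemma tensmap_surj M M' (f : {linear M -> M'}) N :
  surj f -> surj (@tensmap R M M' f N).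
Proof.
move=> sf z; have [l ->] := tens_spanned z.
elim: l => [|[m n] l [w IH]]; first by exists 0; rewrite raddf0 big_nil.
have [m' m'E] := sf m; exists (tens m' n + w).
by rewrite raddfD /= IH tensmap_tens m'E big_cons.
Qed.

Lemma tensmapr_surj M N N' (f : {linear N -> N'}) :
  surj f -> surj (@tensmapr M N N' f).
Proof.
move=> sf z; have [l ->] := tens_spanned z.
elim: l => [|[m n] l [w IH]]; first by exists 0; rewrite raddf0 big_nil.
have [m' m'E] := sf n; exists (tens m m' + w).
by rewrite raddfD /= IH tensmapr_tens m'E big_cons.
Qed.

(** Right exactness: the cokernel map [q] of [tensmap i] factors as [h \o tensmap p], so whatever
    [tensmap p] kills is killed by [q]. *)
Lemma tensmap_exact (K P M : rmod R) (i : {linear K -> P}) (p : {linear P -> M}) N :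
  surj p -> exact_at i p -> forall z : tensor P N,
  tensmap p z = 0 <-> exists w, tensmap i w = z.
Proof.
move=> ps ip z; split=> [pz|[w <-]]; last first.
  rewrite (@tensmap_comp _ _ _ _ _ (p \o i)) // tensmap0 // => x.
  by apply/ip; exists x.
have [Q [q qE]] := cokernel_exists (@tensmap R K P i N).
pose s y := projT1 (cid (ps y)).
have sK y : p (s y) = y by rewrite /s; case: cid.
have qs x y n : p x = p y -> q (tens x n) = q (tens y n).
  move=> e; apply/eqP; rewrite -subr_eq0 -raddfB; apply/eqP/qE.
  have [k kE] : exists k, i k = x - y by apply/ip; rewrite linearB e subrr.
  by exists (tens k n); rewrite /= tensmap_tens kE tensBl.
(* The section [s] is only set-theoretic, but by [qs] its choice is invisible after [q], so the
   formula is balanced. *)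
have [|h hE] := @tens_universal M N Q (fun m n => q (tens (s m) n)).
  split=> [m m' n|m n n'|m r n].
  - by rewrite -raddfD -tensDl; apply: qs; rewrite linearD !sK.
  - by rewrite tensDr raddfD.
  - by rewrite -tensZ; apply: qs; rewrite linearZ !sK.
apply/qE; rewrite -(raddf0 h) -pz.
apply: (tens_ext (f := q) (g := h \o tensmap p)) => m n /=.
by rewrite tensmap_tens hE; apply: qs; rewrite sK.
Qed.

Lemma tensmapr_exact M (K P N : lmod R) (i : {linear K -> P}) (p : {linear P -> N}) :
  surj p -> exact_at i p -> forall z : tensor M P,
  tensmapr p z = 0 <-> exists w, tensmapr i w = z.
Proof.
move=> ps ip z; split=> [pz|[w <-]]; last first.
  rewrite (@tensmapr_comp _ _ _ _ _ _ (p \o i)) // tensmapr0 // => x.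
  by apply/ip; exists x.
have [Q [q qE]] := cokernel_exists (@tensmapr M K P i).
pose s y := projT1 (cid (ps y)).
have sK y : p (s y) = y by rewrite /s; case: cid.
have qs m x y : p x = p y -> q (tens m x) = q (tens m y).
  move=> e; apply/eqP; rewrite -subr_eq0 -raddfB; apply/eqP/qE.
  have [k kE] : exists k, i k = x - y by apply/ip; rewrite linearB e subrr.
  by exists (tens m k); rewrite /= tensmapr_tens kE tensBr.
have [|h hE] := @tens_universal M N Q (fun m n => q (tens m (s n))).
  split=> [m m' n|m n n'|m r n].
  - by rewrite tensDl raddfD.
  - by rewrite -raddfD -tensDr; apply: qs; rewrite linearD !sK.
  - by rewrite tensZ; apply: qs; rewrite linearZ !sK.
apply/qE; rewrite -(raddf0 h) -pz.
apply: (tens_ext (f := q) (g := h \o tensmapr p)) => m n /=.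
by rewrite tensmapr_tens hE; apply: qs; rewrite sK.
Qed.

End TensorTheory.

(** * Tensor products with free modules, and flatness of projective modules *)

Section FreeCoordinates.
Variables (R : pzRingType) (X : choiceType).

Fact coordl_balanced (M : rmod R) (x : X) :
  balanced (fun (m : M) (f : freemod R X) => (coef f x : R^c) *: m).
Proof.
split=> [m m' f|m f g|m r f]; first by rewrite scalerDr.
  by rewrite -scalerDl.
by rewrite scalerA.
Qed.
Definition coordl (M : rmod R) x : {additive tensor M (freemod R X) -> M} :=
  Add (tens_lift_additive (coordl_balanced M x)).
Lemma coordl_tens (M : rmod R) x (m : M) f :
  coordl M x (tens m f) = (coef f x : R^c) *: m.
Proof. exact: (tens_lift_tens (coordl_balanced M x)). Qed.

Fact coordr_balanced (N : lmod R) (x : X) :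
  balanced (fun (f : freemod R^c X) (n : N) => (coef f x : R) *: n).
Proof.
split=> [f g n|f n n'|f r n]; first by rewrite -scalerDl.
  by rewrite scalerDr.
by rewrite scalerA.
Qed.
Definition coordr (N : lmod R) x : {additive tensor (freemod R^c X) N -> N} :=
  Add (tens_lift_additive (coordr_balanced N x)).
Lemma coordr_tens (N : lmod R) x f (n : N) :
  coordr N x (tens f n) = (coef f x : R) *: n.
Proof. exact: (tens_lift_tens (coordr_balanced N x)). Qed.

(** Quantifying over all larger lists [t] lets the induction on a sum of elementary tensors merge
    the supports of the summands. *)
Lemma coordl_sum (M : rmod R) (z : tensor M (freemod R X)) :
  exists s : seq X, forall t : seq X, uniq t -> {subset s <= t} ->
    z = \sum_(x <- t) tens (coordl M x z) (delta R x).
Proof.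
have [l ->] := tens_spanned z.
elim: l => [|[m f] l [s IH]].
  exists [::] => t _ _; rewrite big_nil big1 // => x _.
  by rewrite raddf0 tens0l.
have [s' [us' hs']] := supp_exists f.
exists (s' ++ s) => t ut st; rewrite big_cons -[tens _.1 _.2]/(tens m f).
under [RHS]eq_bigr => x _ do rewrite (raddfD (coordl M x)) tensDl.
rewrite big_split /=; congr (_ + _); last first.
  by apply: IH => // x xs; apply: st; rewrite mem_cat xs orbT.
rewrite {1}(@freemodE _ _ f t) //; last first.
  by move=> x /hs' xs; apply: st; rewrite mem_cat xs.
by rewrite tens_sumr; apply: eq_bigr => x _; rewrite coordl_tens tensZ.
Qed.

Lemma coordr_sum (N : lmod R) (z : tensor (freemod R^c X) N) :
  exists s : seq X, forall t : seq X, uniq t -> {subset s <= t} ->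
    z = \sum_(x <- t) tens (delta R^c x) (coordr N x z).
Proof.
have [l ->] := tens_spanned z.
elim: l => [|[f n] l [s IH]].
  exists [::] => t _ _; rewrite big_nil big1 // => x _.
  by rewrite raddf0 tens0r.
have [s' [us' hs']] := supp_exists f.
exists (s' ++ s) => t ut st; rewrite big_cons -[tens _.1 _.2]/(tens f n).
under [RHS]eq_bigr => x _ do rewrite (raddfD (coordr N x)) tensDr.
rewrite big_split /=; congr (_ + _); last first.
  by apply: IH => // x xs; apply: st; rewrite mem_cat xs orbT.
rewrite {1}(@freemodE _ _ f t) //; last first.
  by move=> x /hs' xs; apply: st; rewrite mem_cat xs.
by rewrite tens_suml; apply: eq_bigr => x _; rewrite coordr_tens -tensZ.
Qed.

Lemma coordl_eq0 (M : rmod R) (z : tensor M (freemod R X)) :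
  (forall x, coordl M x z = 0) -> z = 0.
Proof.
move=> z0; have [s /(_ (undup s) (undup_uniq s))->] := coordl_sum z.
  by rewrite big1 // => x _; rewrite z0 tens0l.
by move=> x; rewrite mem_undup.
Qed.

Lemma coordr_eq0 (N : lmod R) (z : tensor (freemod R^c X) N) :
  (forall x, coordr N x z = 0) -> z = 0.
Proof.
move=> z0; have [s /(_ (undup s) (undup_uniq s))->] := coordr_sum z.
  by rewrite big1 // => x _; rewrite z0 tens0r.
by move=> x; rewrite mem_undup.
Qed.

Lemma coordl_tensmap (M M' : rmod R) (f : {linear M -> M'}) x z :
  coordl M' x (tensmap f z) = f (coordl M x z).
Proof.
apply: (tens_ext (f := coordl M' x \o tensmap f) (g := f \o coordl M x)).
by move=> m g; rewrite /= tensmap_tens !coordl_tens linearZ.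
Qed.

Lemma coordr_tensmapr (N N' : lmod R) (f : {linear N -> N'}) x z :
  coordr N' x (tensmapr f z) = f (coordr N x z).
Proof.
apply: (tens_ext (f := coordr N' x \o tensmapr f) (g := f \o coordr N x)).
by move=> m g; rewrite /= tensmapr_tens !coordr_tens linearZ.
Qed.

End FreeCoordinates.

Lemma projective_retract (A : pzRingType) (P : lmodType A) : projective P ->
  exists s : {linear P -> freemod A P}, forall x, fsum id (s x) = x.
Proof. by move=> pP; exact: (pP _ _ (@fsum A P P id) idfun (@fsum_surj A P)). Qed.

Section Flatness.
Variable R : pzRingType.

(** [P] is a retract of a free module, and over a free module injectivity is checked on
    coordinates. *)
Lemma projective_flatl (M M' : rmod R) (f : {linear M -> M'}) (P : lmod R) :
  injective f -> projective P -> forall z : tensor M P, tensmap f z = 0 -> z = 0.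
Proof.
move=> inj_f /projective_retract[s sK] z fz.
have sz0 : tensmapr s z = 0.
  apply: coordl_eq0 => x; apply: inj_f.
  by rewrite -coordl_tensmap tensmapC fz !raddf0.
rewrite -[z](@tensmapr_id _ _ _ (fsum id \o s)) //.
by rewrite -(@tensmapr_comp _ _ _ _ _ s (fsum id)) // sz0 raddf0.
Qed.

Lemma projective_flatr (N N' : lmod R) (f : {linear N -> N'}) (P : rmod R) :
  injective f -> projective P -> forall z : tensor P N, tensmapr f z = 0 -> z = 0.
Proof.
move=> inj_f /projective_retract[s sK] z fz.
have sz0 : tensmap s z = 0.
  apply: coordr_eq0 => x; apply: inj_f.
  by rewrite -coordr_tensmapr -tensmapC fz !raddf0.
rewrite -[z](@tensmap_id _ _ (fsum id \o s)) //.
by rewrite -(@tensmap_comp _ _ _ _ s (fsum id)) // sz0 raddf0.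
Qed.

End Flatness.

(** * Vanishing of Tor *)

Section ShortExact.
Variable A : pzRingType.

Definition ker_incl (U V : lmodType A) (f : {linear U -> V}) :
  {linear kermod f -> U} := val.

Lemma ker_exact (U V : lmodType A) (f : {linear U -> V}) :
  exact_at (ker_incl f) f.
Proof.
move=> y; split=> [/ker_lift[x xE]|[x <-]]; first by exists x.
exact: ker_val_eq0.
Qed.

Lemma ker_short_exact (U V : lmodType A) (f : {linear U -> V}) :
  surj f -> short_exact (ker_incl f) f.
Proof. by move=> sf; split; [exact: val_inj | exact: ker_exact | exact: sf]. Qed.

Lemma free_short_exact (M : lmodType A) :
  short_exact (ker_incl (@fsum A M M id)) (@fsum A M M id).
Proof. exact/ker_short_exact/fsum_surj. Qed.

(** Corestricts [f] to the kernel of [g], onto which it maps by exactness; this cuts a resolution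
    into short exact sequences. *)
Lemma exact_short_exact (U V W : lmodType A) (f : {linear U -> V})
    (g : {linear V -> W}) : exact_at f g ->
  exists e : {linear U -> kermod g},
    (forall x, ker_incl g (e x) = f x) /\ short_exact (ker_incl f) e.
Proof.
move=> fg; have [||e eE] := @factor_inj _ _ _ _ (ker_incl g) f.
- exact: val_inj.
- by move=> x; apply: ker_lift; apply/fg; exists x.
exists e; split=> //; split; first exact: val_inj.
  move=> x; rewrite -(ker_exact f) -eE.
  by split=> [->|h]; [rewrite linear0 | apply: val_inj; rewrite raddf0].
move=> y; have /fg[x xE] := ker_val_eq0 y.
by exists x; apply: val_inj; rewrite -xE -eE.
Qed.

End ShortExact.

(** * Balance of Tor and dimension shifting *)

Section TorDiagram.
Variables (KL KF KN PL PF PN ML MF : zmodType).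
Variables (i : {additive KL -> KF}) (p : {additive KF -> KN}).
Variables (a : {additive KL -> PL}) (b : {additive KF -> PF}).
Variables (c : {additive KN -> PN}) (j : {additive PL -> PF}).
Variables (q : {additive PF -> PN}) (d : {additive PL -> ML}).
Variables (e : {additive PF -> MF}) (k : {additive ML -> MF}).

(** The chase in the 3 by 3 diagram obtained by tensoring two short exact sequences. It is stated
    for abelian groups so that the transposed diagram is covered too. *)
Lemma diagram_chase :
  (forall x, e (j x) = k (d x)) -> (forall x, c (p x) = q (b x)) ->
  (forall x, j (a x) = b (i x)) -> (forall x, q (j x) = 0) ->
  (forall x, d (a x) = 0) -> surj d ->
  (forall x, e x = 0 -> exists u, b u = x) ->
  (forall x, p x = 0 -> exists u, i u = x) ->
  (forall x, j x = 0 -> x = 0) -> (forall x, c x = 0 -> x = 0) ->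
  forall x, k x = 0 -> x = 0.
Proof.
move=> ej cp ja qj da sd eb ip j0 c0 y ky.
have [x xE] := sd y.
have [u uE] : exists u, b u = j x by apply: eb; rewrite ej xE.
have [v vE] : exists v, i v = u by apply: ip; apply: c0; rewrite cp uE qj.
have xv : x = a v.
  by apply/eqP; rewrite -subr_eq0; apply/eqP/j0; rewrite raddfB ja vE uE subrr.
by rewrite -xE xv da.
Qed.
End TorDiagram.

Section Tor1.
Variable R : pzRingType.

Definition tensl_inj (K P : rmod R) (i : {linear K -> P}) (N : lmod R) :=
  forall z : tensor K N, tensmap i z = 0 -> z = 0.
Definition tensr_inj (M : rmod R) (L F : lmod R) (j : {linear L -> F}) :=
  forall z : tensor M L, tensmapr j z = 0 -> z = 0.

Section Balance.
Variables (K P M : rmod R) (i : {linear K -> P}) (p : {linear P -> M}).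
Variables (L F N : lmod R) (j : {linear L -> F}) (q : {linear F -> N}).
Hypotheses (ip : short_exact i p) (jq : short_exact j q).

(** Stated for arbitrary short exact sequences: it yields one half of the balance of Tor and also
    the passage of Tor vanishing to pure quotients. *)
Lemma tensl_inj_tensr_inj :
  tensr_inj P j -> tensl_inj i N -> tensr_inj M j.
Proof.
case: ip jq => _ eip sp [_ ejq sq] hj hi.
have epP := tensmap_exact sp eip; have eqP := tensmapr_exact sq ejq.
apply: (@diagram_chase (tensor K L) (tensor K F) (tensor K N)
  (tensor P L) (tensor P F) (tensor P N) (tensor M L) (tensor M F)
  (tensmapr j) (tensmapr q) (tensmap i)
  (tensmap i) (tensmap i) (tensmapr j) (tensmapr q) (tensmap p) (tensmap p)
  (tensmapr j)) => //=.
- by move=> x; rewrite tensmapC.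
- by move=> x; rewrite tensmapC.
- by move=> x; rewrite tensmapC.
- by move=> x; apply/eqP; exists x.
- by move=> x; apply/epP; exists x.
- exact: tensmap_surj.
- by move=> x /epP.
- by move=> x /eqP.
Qed.

Lemma tensr_inj_tensl_inj :
  tensl_inj i F -> tensr_inj M j -> tensl_inj i N.
Proof.
case: ip jq => _ eip sp [_ ejq sq] hi hj.
have epP := tensmap_exact sp eip; have eqP := tensmapr_exact sq ejq.
apply: (@diagram_chase (tensor K L) (tensor P L) (tensor M L)
  (tensor K F) (tensor P F) (tensor M F) (tensor K N) (tensor P N)
  (tensmap i) (tensmap p) (tensmapr j)
  (tensmapr j) (tensmapr j) (tensmap i) (tensmap p) (tensmapr q) (tensmapr q)
  (tensmap i)) => //=.
- by move=> x; rewrite tensmapC.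
- by move=> x; rewrite tensmapC.
- by move=> x; rewrite tensmapC.
- by move=> x; apply/epP; exists x.
- by move=> x; apply/eqP; exists x.
- exact: tensmapr_surj.
- by move=> x /eqP.
- by move=> x /epP.
Qed.

Lemma Tor1_balance : projective P -> projective F ->
  tensl_inj i N <-> tensr_inj M j.
Proof.
case: ip jq => ii _ _ [ij _ _] pP pF; split.
  by apply: tensl_inj_tensr_inj; exact: projective_flatr.
by apply: tensr_inj_tensl_inj; exact: projective_flatl.
Qed.

End Balance.

(** The composites of K ⊗ L → K ⊗ F → P ⊗ F and K ⊗ L → P ⊗ L → P ⊗ F coincide, and the first map of
    an injective composite is injective. *)
Lemma tensl_inj_of_tensr_inj (K P : rmod R) (i : {linear K -> P}) (L F : lmod R)
    (j : {linear L -> F}) :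
  tensl_inj i F -> tensr_inj K j -> tensl_inj i L.
Proof. by move=> hi h z hz; apply: h; apply: hi; rewrite tensmapC hz raddf0. Qed.

Lemma tensr_inj_of_tensl_inj (K P : rmod R) (i : {linear K -> P}) (L F : lmod R)
    (j : {linear L -> F}) :
  tensr_inj P j -> tensl_inj i L -> tensr_inj K j.
Proof. by move=> hj h z hz; apply: h; apply: hj; rewrite -tensmapC hz raddf0. Qed.

(** The differential d_1 is a surjection [e] onto the kernel of d_0 followed by the inclusion; by
    right exactness the kernel of e ⊗ N is the image of d_2 ⊗ N. *)
Lemma resolution_tensl_inj (M : rmod R) (P : proj_resolution M) (N : lmod R) :
  (forall z : tensor (res_P P 1) N, tensmap (res_dS P 0) z = 0 ->
    exists w : tensor (res_P P 2) N, tensmap (res_dS P 1) w = z) <->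
  tensl_inj (ker_incl (res_d0 P)) N.
Proof.
have [e [eE [_ _ se]]] := exact_short_exact (@res_exact0 _ _ P).
have ee : exact_at (res_dS P 1) e.
  move=> y; rewrite -(@res_exactS _ _ P 0 y) -eE.
  by split=> [->|h]; [rewrite linear0 | apply: val_inj; rewrite raddf0].
have eP := tensmap_exact se ee.
have eC z : tensmap (ker_incl (res_d0 P)) (tensmap e z) = tensmap (res_dS P 0) z
  :> tensor _ N by apply: tensmap_comp.
split=> h z.
  have [w <-] := @tensmap_surj _ _ _ e N se z.
  by rewrite eC => /h hw; apply/eP.
by rewrite -eC => /h /eP.
Qed.

(** Every projective presentation of [M] is compared, by balance, with the same free presentation of
    [N]; this is the independence of the resolution. *)
Lemma Tor1_zeroEl (K P M : rmod R) (i : {linear K -> P}) (p : {linear P -> M})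
    (N : lmod R) : short_exact i p -> projective P ->
  Tor1_zero M N <-> tensl_inj i N.
Proof.
move=> ip pP; have fN := free_short_exact N.
have bal (K' P' : rmod R) (i' : {linear K' -> P'}) (p' : {linear P' -> M}) :
    short_exact i' p' -> projective P' ->
    tensl_inj i' N <-> tensr_inj M (ker_incl (@fsum R N N id)).
  by move=> ip' pP'; apply: (Tor1_balance ip' fN pP'); exact: freemod_projective.
have res (Q : proj_resolution M) :
    tensl_inj (ker_incl (res_d0 Q)) N <-> tensl_inj i N.
  rewrite (bal _ _ _ _ ip pP); apply: bal.
    exact: ker_short_exact (@res_surj _ _ Q).
  exact: res_projective.
split=> [h|h Q]; last by apply/resolution_tensl_inj/res.
have [Q] := proj_resolution_exists M.
by apply/(res Q)/resolution_tensl_inj/h.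
Qed.

Lemma Tor1_zeroEr (M : rmod R) (L F N : lmod R) (j : {linear L -> F})
    (q : {linear F -> N}) : short_exact j q -> projective F ->
  Tor1_zero M N <-> tensr_inj M j.
Proof.
move=> jq pF; have fM := free_short_exact M.
have pM := freemod_projective (A := R^c) (X := M).
by rewrite (Tor1_zeroEl N fM pM) (Tor1_balance fM jq pM pF).
Qed.

(** Both sides say Tor_2(M, N) = 0: as P and F are flat, each is equivalent to injectivity of K ⊗ L
    → P ⊗ F. *)
Lemma Tor1_shift (K P M : rmod R) (i : {linear K -> P}) (p : {linear P -> M})
    (L F N : lmod R) (j : {linear L -> F}) (q : {linear F -> N}) :
  short_exact i p -> short_exact j q -> projective P -> projective F ->
  Tor1_zero K N <-> Tor1_zero M L.
Proof.
move=> ip jq pP pF.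
rewrite (Tor1_zeroEr K jq pF) (Tor1_zeroEl L ip pP).
case: ip jq => ii _ _ [ij _ _]; split.
  by apply: tensl_inj_of_tensr_inj; exact: projective_flatl.
by apply: tensr_inj_of_tensl_inj; exact: projective_flatr.
Qed.

End Tor1.

(** * Closure properties of Tor-orthogonal classes *)

Section Syzygies.
Variable A : pzRingType.

Lemma syzygy_short_exact (M : lmodType A) (P : proj_resolution M) n :
  exists e : {linear res_P P n.+1 -> syzygy P n},
    short_exact (ker_incl (res_dS P n)) e.
Proof.
case: n => [|n].
  by have [e []] := exact_short_exact (@res_exact0 _ _ P); exists e.
by have [e []] := exact_short_exact (@res_exactS _ _ P n); exists e.
Qed.

Lemma free_syz_comm (N : lmodType A) n :
  free_syz (free_syz N 1) n = free_syz N n.+1.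
Proof.
elim: n => [//|n IH].
(* The syzygy as a function of the module, so that the equality of modules [IH] can be rewritten in
   its argument. *)
pose Om (M : lmodType A) : lmodType A := kermod (@fsum A M M id).
by rewrite -[LHS]/(Om (free_syz (free_syz N 1) n)) IH.
Qed.

End Syzygies.

Section TorClass.
Variable R : pzRingType.

Lemma Tor1_syzygy (M : rmod R) (P : proj_resolution M) (N : lmod R) n :
  Tor1_zero (syzygy P n) N <-> Tor1_zero M (free_syz N n.+1).
Proof.
elim: n N => [|n IH] N.
  apply: (Tor1_shift (ker_short_exact (@res_surj _ _ P)) (free_short_exact N)).
    exact: res_projective.
  exact: freemod_projective.
have [e eE] := syzygy_short_exact P n.
rewrite -free_syz_comm -IH.
apply: (Tor1_shift eE (free_short_exact N)); first exact: res_projective.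
exact: freemod_projective.
Qed.

(** The right-hand side mentions no resolution of [M], so any resolution can serve as the
    witness. *)
Lemma rel_dim_Tor1 (T : mclass R^c) (S : mclass R) k (M : rmod R) :
  tor_pair T S ->
  rel_dim T k M <-> forall N, S N -> Tor1_zero M (free_syz N k).
Proof.
case=> TS _; case: k => [|k]; first exact: TS.
split=> [[P /TS h] N /h /Tor1_syzygy //|h].
have [P] := proj_resolution_exists M.
by exists P; apply/TS => N /h hN; apply/Tor1_syzygy.
Qed.

Lemma Tor1_pure_quotient (K X M : rmod R) (i : {linear K -> X})
    (p : {linear X -> M}) (N : lmod R) : short_exact i p ->
  tensl_inj i N -> Tor1_zero X N -> Tor1_zero M N.
Proof.
move=> ip hi.
have fN := free_short_exact N; have pF := freemod_projective (A := R) (X := N).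
move=> /(Tor1_zeroEr X fN pF) hX; apply/(Tor1_zeroEr M fN pF).
exact: (tensl_inj_tensr_inj ip fN).
Qed.

Lemma Tor1_pure_sub (K X : rmod R) (i : {linear K -> X}) (N : lmod R) :
  (forall L, tensl_inj i L) -> Tor1_zero X N -> Tor1_zero K N.
Proof.
move=> hi.
have fN := free_short_exact N; have pF := freemod_projective (A := R) (X := N).
move=> /(Tor1_zeroEr X fN pF) hX; apply/(Tor1_zeroEr K fN pF).
exact: tensr_inj_of_tensl_inj hX (hi _).
Qed.

(** The part Tor_2(X, N) → Tor_2(M, N) → Tor_1(K, N) of the long exact sequence, with Tor_2 written
    as Tor_1 against the first syzygy of [N]. *)
Lemma Tor1_cokernel (K X M : rmod R) (i : {linear K -> X})
    (p : {linear X -> M}) (N : lmod R) : short_exact i p ->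
  Tor1_zero K N -> Tor1_zero X (free_syz N 1) -> Tor1_zero M (free_syz N 1).
Proof.
move=> ip hK; apply: (Tor1_pure_quotient ip).
have fN := free_short_exact N; have pF := freemod_projective (A := R) (X := N).
move/(Tor1_zeroEr K fN pF): hK; apply: tensl_inj_of_tensr_inj.
by case: ip => ii _ _; exact: projective_flatl.
Qed.

End TorClass.

(** * Direct sums *)

Section DirectSum.
Variables (A : pzRingType) (J : choiceType) (X : J -> lmodType A).

Definition dsum_pred : {pred dprod X} :=
  fun x => `[< exists s : seq J, forall j, x j != 0 -> j \in s >].

Fact dsum_pred_submod : submod_closed dsum_pred.
Proof.
split=> [|a x y]; rewrite !unfold_in.
  by apply/asboolP; exists [::] => j; rewrite eqxx.
move=> /asboolP[s hs] /asboolP[t ht]; apply/asboolP; exists (s ++ t) => j.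
rewrite mem_cat; apply: contraNT; rewrite negb_or => /andP[js jt].
have /eqP xj : x j == 0 by apply: contraNT js => /hs.
have /eqP yj : y j == 0 by apply: contraNT jt => /ht.
by rewrite [X in X == _](_ : _ = a *: x j + y j) // xj yj scaler0 addr0.
Qed.

(** Dividing the product by the finitely supported families and taking the kernel turns that
    predicate into a module. *)
Definition dsum : lmodType A := kermod (quo_proj dsum_pred_submod).

Definition dsum_proj j : {linear dsum -> X j} :=
  @dproj A J X j \o ker_incl (quo_proj dsum_pred_submod).

Lemma dsum_supp (x : dsum) :
  exists s : seq J, forall j, dsum_proj j x != 0 -> j \in s.
Proof. by have /quo_proj_eq0/asboolP := ker_val_eq0 x. Qed.

Lemma dsum_eq (x y : dsum) :
  (forall j, dsum_proj j x = dsum_proj j y) -> x = y.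
Proof.
by move=> xy; apply: val_inj; apply: functional_extensionality_dep => j; exact: xy.
Qed.

Let inj_fun j (x : X j) : dprod X :=
  @dfwith J (fun k => X k) (fun=> 0) j x.
Let inj_linear j : linear (@inj_fun j).
Proof.
move=> a x y; apply: functional_extensionality_dep => k.
rewrite [RHS](_ : _ = a *: inj_fun x k + inj_fun y k) // /inj_fun.
case: (eqVneq j k) => [jk|jk]; last by rewrite !dfwith_out ?scaler0 ?addr0.
by case: k / jk; rewrite !dfwith_in.
Qed.

Lemma dsum_inj_exists j : exists f : {linear X j -> dsum},
  (forall x, dsum_proj j (f x) = x) /\
  (forall k x, j != k -> dsum_proj k (f x) = 0).
Proof.
have [||f fE] := @factor_inj _ _ _ _ (ker_incl (quo_proj dsum_pred_submod))
  (Lin (@inj_linear j)).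
- exact: val_inj.
- move=> x; apply: ker_lift; apply/quo_proj_eq0/asboolP.
  exists [:: j] => k; rewrite inE; apply: contraNT => kj.
  by rewrite LinE /inj_fun dfwith_out // eq_sym.
exists f; split=> [x|k x jk].
  by rewrite /dsum_proj /= [val _]fE /dproj LinE /inj_fun dfwith_in.
by rewrite /dsum_proj /= [val _]fE /dproj LinE /inj_fun dfwith_out.
Qed.

Definition dsum_inj j := projT1 (cid (dsum_inj_exists j)).
Lemma dsum_projK j x : dsum_proj j (dsum_inj j x) = x.
Proof. by rewrite /dsum_inj; case: cid => f [/= h _]; exact: h. Qed.
Lemma dsum_proj_inj0 j k x : j != k -> dsum_proj k (dsum_inj j x) = 0.
Proof. by rewrite /dsum_inj; case: cid => f [/= _ h]; exact: h. Qed.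

Lemma big_supp (M : zmodType) (F : J -> M) (s t : seq J) :
  uniq s -> uniq t -> (forall j, F j != 0 -> j \in s) -> {subset s <= t} ->
  \sum_(j <- t) F j = \sum_(j <- s) F j.
Proof.
move=> us ut hs st; rewrite (bigID (mem s)) /= [X in _ + X]big1 ?addr0.
  rewrite -big_filter; apply: perm_big; apply: uniq_perm => //.
    exact: filter_uniq.
  by move=> j; rewrite mem_filter andb_idr //; exact: st.
by move=> j js; apply/eqP; apply: contraNT js; exact: hs.
Qed.

Lemma dsum_decomp (x : dsum) : exists s : seq J, forall t, uniq t ->
  {subset s <= t} -> x = \sum_(j <- t) dsum_inj j (dsum_proj j x).
Proof.
have [s hs] := dsum_supp x; exists s => t ut st; apply: dsum_eq => k.
rewrite linear_sum; have [kt|kt] := boolP (k \in t).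
  rewrite (bigD1_seq k) // dsum_projK big1 => [|j jk].
    exact/esym/addr0.
  exact: dsum_proj_inj0.
rewrite big_seq big1; first by apply/eqP; apply: contraNT kt => /hs/st.
by move=> j jt; apply: dsum_proj_inj0; apply: contraNneq kt => <-.
Qed.

Lemma dsum_universal (M : lmodType A) (f : forall j, {linear X j -> M}) :
  exists g : {linear dsum -> M}, forall j x, g (dsum_inj j x) = f j x.
Proof.
pose supp x := undup (projT1 (cid (dsum_supp x))).
pose g x := \sum_(j <- supp x) f j (dsum_proj j x).
have gE x t : uniq t -> (forall j, dsum_proj j x != 0 -> j \in t) ->
    g x = \sum_(j <- t) f j (dsum_proj j x).
  have hsupp j : dsum_proj j x != 0 -> j \in supp x.
    by rewrite mem_undup; case: cid => s /= /(_ j).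
  have nz j : f j (dsum_proj j x) != 0 -> dsum_proj j x != 0.
    by apply: contraNneq => ->; rewrite linear0.
  move=> ut ht; rewrite /g.
  rewrite -(@big_supp _ _ (supp x) (undup (supp x ++ t))) ?undup_uniq //.
  - rewrite (@big_supp _ _ t (undup (supp x ++ t))) ?undup_uniq //.
      by move=> j /nz/ht.
    by move=> j jt; rewrite mem_undup mem_cat jt orbT.
  - by move=> j /nz/hsupp.
  - by move=> j jt; rewrite mem_undup mem_cat jt.
have gL : linear g.
  move=> a x y; have [s hs] := dsum_supp x; have [t ht] := dsum_supp y.
  pose u := undup (s ++ t).
  have hx j : dsum_proj j x != 0 -> j \in u.
    by move=> /hs js; rewrite mem_undup mem_cat js.
  have hy j : dsum_proj j y != 0 -> j \in u.
    by move=> /ht js; rewrite mem_undup mem_cat js orbT.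
  rewrite !(gE _ u) ?undup_uniq // ?scaler_sumr -?big_split /=.
    by apply: eq_bigr => j _; rewrite !linearP.
  move=> j; apply: contraNT => ju.
  rewrite [X in X == _](_ : _ = a *: dsum_proj j x + dsum_proj j y) ?linearP //.
  have /eqP -> : dsum_proj j x == 0 by apply: contraNT ju => /hx.
  have /eqP -> : dsum_proj j y == 0 by apply: contraNT ju => /hy.
  by rewrite scaler0 addr0.
exists (Lin gL) => j x; rewrite LinE (gE _ [:: j]) //.
  by rewrite big_seq1 dsum_projK.
by move=> k; rewrite inE; apply: contraNT; rewrite eq_sym => /dsum_proj_inj0->.
Qed.

End DirectSum.

(** An element of the tensor product is the finite sum of its components, and injectivity for each
    [X j] kills them one by one. *)
Lemma Tor1_dsum (R : pzRingType) (J : choiceType) (X : J -> rmod R) (N : lmod R) :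
  (forall j, Tor1_zero (X j) N) -> Tor1_zero (dsum X) N.
Proof.
have fN := free_short_exact N; have pF := freemod_projective (A := R) (X := N).
move=> hX; apply/(Tor1_zeroEr _ fN pF) => z hz.
have [s hs] : exists s : seq J, forall t, uniq t -> {subset s <= t} ->
    z = \sum_(j <- t) tensmap (dsum_inj X j) (tensmap (dsum_proj X j) z).
  have [l ->] := tens_spanned z.
  elim: l => [|[m n] l [s IH]].
    by exists [::] => t _ _; rewrite big_nil big1 // => j _; rewrite !raddf0.
  have [s' hs'] := dsum_decomp m.
  exists (s' ++ s) => t ut st; rewrite big_cons -[tens _.1 _.2]/(tens m n).
  under [RHS]eq_bigr => j _ do rewrite !raddfD.
  rewrite big_split /=; congr (_ + _); last first.
    by apply: IH => // x xs; apply: st; rewrite mem_cat xs orbT.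
  rewrite {1}(hs' t) //; last by move=> x xs; apply: st; rewrite mem_cat xs.
  by rewrite tens_suml; apply: eq_bigr => j _; rewrite !tensmap_tens.
rewrite (hs (undup s)) ?undup_uniq //; last by move=> j; rewrite mem_undup.
rewrite big1 // => j _; rewrite [tensmap (dsum_proj X j) z](_ : _ = 0) ?raddf0 //.
by move/(Tor1_zeroEr _ fN pF): (hX j); apply; rewrite -tensmapC hz raddf0.
Qed.

(** * Direct limits *)

Section DirectLimit.
Variables (A : pzRingType) (d : Order.disp_t) (I : porderType d).
Variables (D : direct_system A I) (L : lmodType A).
Variables (l : forall i, {linear ds_obj D i -> L}) (lim : is_direct_limit l).

Let coc i j (ij : (i <= j)%O) x : l j (ds_mor D ij x) = l i x.
Proof. by case: lim => h _; exact: h. Qed.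

(** The zero map and the projection modulo the union of the images both induce the zero cocone, so
    they agree by uniqueness. *)
Lemma dlim_surj (y : L) : exists i x, l i x = y.
Proof.
pose U : {pred L} := fun y => `[< exists i x, l i x = y >].
have Usub : submod_closed U.
  split=> [|a u v]; rewrite !unfold_in.
    by have [i] := ds_nonempty D; apply/asboolP; exists i, 0; rewrite linear0.
  move=> /asboolP[i [x <-]] /asboolP[j [x' <-]]; apply/asboolP.
  have [k [ik jk]] := ds_directed D i j.
  by exists k, (a *: ds_mor D ik x + ds_mor D jk x'); rewrite linearP !coc.
have [_ /(_ (quomod Usub) (fun=> \0)) univ] := lim.
have [|u _ uniq_u] := univ; first by [].
suff : quo_proj Usub y = 0 by move=> /quo_proj_eq0/asboolP.
rewrite (uniq_u (quo_proj Usub)) -?(uniq_u \0) // => i x.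
by apply/quo_proj_eq0/asboolP; exists i, x.
Qed.

(* The limit maps to the product of all [ds_obj D i] modulo the families that
   vanish eventually; an element of [ds_obj D i] goes to its tail of images. *)
Lemma dlim_eq0 i (x : ds_obj D i) : l i x = 0 ->
  exists j (ij : (i <= j)%O), ds_mor D ij x = 0.
Proof.
pose P := dprod (ds_obj D).
pose U : {pred P} := fun y => `[< exists k, forall j, (k <= j)%O -> y j = 0 >].
have Usub : submod_closed U.
  split=> [|a u v]; rewrite !unfold_in.
    by have [k] := ds_nonempty D; apply/asboolP; exists k.
  move=> /asboolP[k hk] /asboolP[k' hk']; apply/asboolP.
  have [m [km km']] := ds_directed D k k'; exists m => j mj.
  rewrite [LHS](_ : _ = a *: u j + v j) // hk ?hk' ?scaler0 ?addr0 //.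
    exact: le_trans mj.
  exact: le_trans mj.
(* The value 0 at indices not above [j] is harmless: modulo [U] only the entries from some index on
   count. *)
pose tail j (y : ds_obj D j) : P := fun k =>
  if pselect (j <= k)%O is left jk then ds_mor D jk y else 0.
have tailL j : linear (@tail j).
  move=> a u v; apply: functional_extensionality_dep => k.
  rewrite [RHS](_ : _ = a *: tail j u k + tail j v k) // /tail.
  by case: pselect => jk; rewrite ?linearP ?scaler0 ?addr0.
have [_ /(_ (quomod Usub) (fun j => quo_proj Usub \o Lin (tailL j)))] := lim.
case=> [j k jk y|u uE _ lx0].
  change (quo_proj Usub (tail k (ds_mor D jk y)) = quo_proj Usub (tail j y)).
  apply/eqP; rewrite -subr_eq0 -linearB; apply/eqP/quo_proj_eq0/asboolP.
  exists k => m km; rewrite [LHS](_ : _ = tail k (ds_mor D jk y) m - tail j y m) //.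
  rewrite /tail; case: pselect => // km'; case: pselect => [jm|[]].
    by rewrite (ds_comp jk km' jm) subrr.
  exact: le_trans km.
have /= := uE i x; rewrite lx0 linear0 => /esym/quo_proj_eq0/asboolP[k hk].
have [m [im km]] := ds_directed D i k.
exists m, im; have : tail i x m = 0 := hk m km.
rewrite /tail.
by case: pselect => [im'|//]; rewrite (bool_irrelevance im' im).
Qed.

Lemma dlim_eq0_seq i (X : eqType) (s : seq X) (f : X -> ds_obj D i) :
  (forall x, l i (f x) = 0) ->
  exists j (ij : (i <= j)%O), forall x, x \in s -> ds_mor D ij (f x) = 0.
Proof.
move=> f0; elim: s => [|x s [j [ij hj]]]; first by exists i, (lexx _).
have [j' [ij' hj']] := dlim_eq0 (f0 x).
have [k [jk jk']] := ds_directed D j j'.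
have ik := le_trans ij jk.
exists k, ik => y; rewrite inE => /predU1P[->|/hj yj].
  by rewrite -(ds_comp ij' jk' ik) hj' linear0.
by rewrite -(ds_comp ij jk ik) yj linear0.
Qed.

End DirectLimit.

(** An element of the kernel comes from some stage; its image there has finitely many nonzero
    coordinates, all zero in the limit, hence zero at a common later stage, where injectivity
    applies. *)
Lemma Tor1_direct_limit (R : pzRingType) (d : Order.disp_t) (I : porderType d)
    (D : direct_system R^c I) (L : rmod R)
    (l : forall i, {linear ds_obj D i -> L}) (N : lmod R) :
  is_direct_limit l -> (forall i, Tor1_zero (ds_obj D i) N) -> Tor1_zero L N.
Proof.
move=> lim hD; have [coc _] := lim.
have fN := free_short_exact N; have pF := freemod_projective (A := R) (X := N).
apply/(Tor1_zeroEr _ fN pF) => z.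
have [i [w <-]] : exists i w, tensmap (l i) w = z.
  have [s ->] := tens_spanned z; elim: s => [|[m n] s [i [w IH]]].
    by have [i] := ds_nonempty D; exists i, 0; rewrite big_nil raddf0.
  have [j [x xE]] := dlim_surj lim m.
  have [k [ik jk]] := ds_directed D i j.
  exists k, (tens (ds_mor D jk x) n + tensmap (ds_mor D ik) w).
  rewrite raddfD /= tensmap_tens coc xE big_cons -IH; congr (_ + _).
  by apply: tensmap_comp => y; exact: coc.
rewrite -tensmapC; set v := tensmapr _ w => v0.
have [s hs] := coordl_sum v.
have [|j [ij hj]] := dlim_eq0_seq lim (undup s) (f := fun x => coordl _ x v).
  by move=> x; rewrite -coordl_tensmap v0 raddf0.
have v'0 : tensmap (ds_mor D ij) v = 0.
  rewrite (hs (undup s)) ?undup_uniq //; last by move=> x; rewrite mem_undup.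
  rewrite raddf_sum big_seq big1 // => x xs.
  by rewrite /= tensmap_tens hj // tens0l.
rewrite -(tensmap_comp w (coc i j ij)).
have /(Tor1_zeroEr _ fN pF) inj_j := hD j.
by rewrite [tensmap (ds_mor D ij) w]inj_j ?raddf0 // -tensmapC.
Qed.

(** * Pure submodules and pure quotients of bounded size *)

Section Submodules.
Variable A : pzRingType.

Definition submodule (V : lmodType A) (P : V -> Prop) :=
  P 0 /\ forall a x y, P x -> P y -> P (a *: x + y).

Lemma submodule_closed (V : lmodType A) (P : V -> Prop) : submodule P ->
  submod_closed (fun x => `[< P x >]).
Proof.
case=> P0 PL; split=> [|a x y]; rewrite !unfold_in; first exact/asboolP.
by move=> /asboolP Px /asboolP Py; apply/asboolP/PL.
Qed.

Lemma submodule_quotient (V : lmodType A) (P : V -> Prop) : submodule P ->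
  exists (C : lmodType A) (q : {linear V -> C}),
    surj q /\ forall x, q x = 0 <-> P x.
Proof.
move=> /submodule_closed Psub; exists (quomod Psub), (quo_proj Psub).
split=> [|x]; first exact: quo_proj_surj.
by split=> [/quo_proj_eq0/asboolP|Px] //; apply/quo_proj_eq0/asboolP.
Qed.

Lemma range_submodule (U V : lmodType A) (f : {linear U -> V}) :
  submodule (fun y => exists x, f x = y).
Proof.
split=> [|a _ _ [x <-] [y <-]]; first by exists 0; rewrite linear0.
by exists (a *: x + y); rewrite linearP.
Qed.

Lemma preim_submodule (U V : lmodType A) (f : {linear U -> V}) (P : V -> Prop) :
  submodule P -> submodule (fun x => P (f x)).
Proof.
by case=> P0 PL; split=> [|a x y Px Py]; rewrite ?linear0 // linearP; exact: PL.
Qed.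

Lemma zero_submodule (V : lmodType A) : submodule (fun x : V => x = 0).
Proof. by split=> // a x y -> ->; rewrite scaler0 addr0. Qed.

Lemma submodule_sum (V : lmodType A) (P : V -> Prop) (I : Type) (s : seq I)
    (F : I -> V) : submodule P -> (forall i, P (F i)) -> P (\sum_(i <- s) F i).
Proof.
case=> P0 PL PF; elim: s => [|i s IH]; first by rewrite big_nil.
by rewrite big_cons -[F i]scale1r; exact: PL.
Qed.

(** Turns a submodule whose elements are named by [X] into the range of a linear map from a free
    module depending on [X] alone. *)
Lemma fsum_range (V : lmodType A) (X : choiceType) (h : X -> V) :
  submodule (fun y => exists x, h x = y) ->
  forall y, (exists u, fsum h u = y) <-> exists x, h x = y.
Proof.
move=> sub y; split=> [[u <-]|[x <-]]; last first.
  by exists (delta A x); rewrite fsum_delta.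
apply: (submodule_sum _ sub) => x; rewrite -[_ *: _]addr0.
by case: (sub) => P0 PL; apply: (PL) => //; exists x.
Qed.

(** Projectivity is applied to the corestriction of [f] to its range, realised as the kernel of the
    cokernel map [q]. *)
Lemma projective_lift (G U V : lmodType A) (f : {linear U -> V})
    (w : {linear G -> V}) : projective G -> (forall y, exists x, f x = w y) ->
  exists v : {linear G -> U}, forall y, f (v y) = w y.
Proof.
move=> pG fw; have [C [q [_ qE]]] := submodule_quotient (range_submodule f).
have [||f' f'E] := @factor_inj _ _ _ _ (ker_incl q) f.
- exact: val_inj.
- by move=> x; apply: ker_lift; apply/qE; exists x.
have [||w' w'E] := @factor_inj _ _ _ _ (ker_incl q) w.
- exact: val_inj.
- by move=> x; apply: ker_lift; apply/qE/fw.
have [|v vE] := pG _ _ f' w'.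
  move=> y; have /qE[x xE] := ker_val_eq0 y.
  by exists x; apply: val_inj; rewrite -xE -f'E.
by exists v => y; rewrite -f'E vE w'E.
Qed.

End Submodules.

(** * Purity and pure closures *)

Section Purity.
Variables (A : pzRingType) (G : lmodType A).

(* For G free on countably many generators this is purity: each finite system
   of equations with right-hand sides in P that is solvable in V (by the images
   of the generators of G) is solvable in P. *)
Definition is_pure (V : lmodType A) (P : V -> Prop) :=
  forall (g : {linear G -> V}) (s : seq G), exists g' : {linear G -> V},
    (forall y, P (g' y)) /\ forall y, y \in s -> P (g y) -> g' y = g y.

Lemma pure_eq (V : lmodType A) (P Q : V -> Prop) :
  (forall x, P x <-> Q x) -> is_pure P -> is_pure Q.
Proof.
move=> PQ hP g s; have [g' [g'P g'E]] := hP g s.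
by exists g'; split=> [y|y ys /PQ]; [exact/PQ | exact: g'E].
Qed.

Lemma pure_zero (V : lmodType A) : is_pure (fun x : V => x = 0).
Proof. by move=> g s; exists \0; split=> // y _ ->. Qed.

(** A solution [h] in [P] of the image system is lifted to [h1]. On the relevant elements [g - h1]
    takes values in the kernel of [q], whose purity supplies the correction [h2]. *)
Lemma pure_preim (V C : lmodType A) (q : {linear V -> C}) (P : C -> Prop) :
  projective G -> surj q -> submodule P -> is_pure (fun x => q x = 0) ->
  is_pure P -> is_pure (fun x => P (q x)).
Proof.
move=> pG sq [P0 PL] hq hP g s.
have [h [hPh hE]] := hP (q \o g) s.
have [h1 h1E] := pG _ _ q h sq.
have [h2 [h2q h2E]] := hq (g \- h1) s.
exists (h1 \+ h2); split=> [y|y ys Pgy].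
  by rewrite /= linearD h2q addr0 h1E.
have qgh : q (g y - h1 y) = 0 by rewrite linearB h1E hE // subrr.
by rewrite /= (h2E y ys qgh) addrC subrK.
Qed.

Section Closure.
Variable X : Type.

(* [Csol s h y] names the value at y of a chosen g : G -> V which, on s, agrees
   modulo Q with the elements named by h. *)
Inductive code : Type :=
| Cgen of X
| Czero
| Clin of A & code & code
| Csol of seq G & (G -> code) & G.

Variables (V : lmodType A) (Q : V -> Prop) (gen : X -> V).

(** The default [\0] makes evaluation total, also on codes naming an unsolvable system. *)
Definition pick_linear (U W : lmodType A) (S : {linear U -> W} -> Prop) :
    {linear U -> W} :=
  if pselect (exists w, S w) is left h then projT1 (cid h) else \0.

Lemma pick_linearP (U W : lmodType A) (S : {linear U -> W} -> Prop) :
  (exists w, S w) -> S (pick_linear S).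
Proof. by rewrite /pick_linear; case: pselect => // h _; case: cid. Qed.

Definition solves (s : seq G) (p : G -> V) (w : {linear G -> V}) :=
  forall y, y \in s -> Q (p y - w y).

Fixpoint ev (c : code) : V :=
  match c with
  | Cgen x => gen x
  | Czero => 0
  | Clin a c c' => a *: ev c + ev c'
  | Csol s h y => pick_linear (solves s (fun z => ev (h z))) y
  end.

Lemma ev_submodule : submodule (fun v => exists c, ev c = v).
Proof.
split=> [|a _ _ [c <-] [c' <-]]; first by exists Czero.
by exists (Clin a c c').
Qed.

(** The solution returned is the one chosen by [pick_linear], whose values [Csol] names; it may
    differ from the given one. *)
Lemma ev_solves s (p : G -> V) : (forall y, exists c, ev c = p y) ->
  (exists w, solves s p w) ->
  exists w, solves s p w /\ forall y, exists c, ev c = w y.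
Proof.
move=> hp; pose h y := projT1 (cid (hp y)).
have -> : p = fun y => ev (h y) by apply: funext => y; rewrite /h; case: cid.
move=> /pick_linearP hw; exists (pick_linear (solves s (fun y => ev (h y)))).
by split=> // y; exists (Csol s h y).
Qed.

End Closure.

Lemma ev_pure (X : Type) (V : lmodType A) (gen : X -> V) :
  is_pure (fun v => exists c, ev (fun x => x = 0) gen c = v).
Proof.
set P := fun v => _; move=> g s.
(* Right-hand sides outside [P] are dropped from [s']; the value 0 there only keeps [p] inside the
   range of [ev]. *)
pose p y := if pselect (P (g y)) is left _ then g y else 0.
pose s' := [seq y <- s | `[< P (g y) >]].
have [||w [wE wP]] := @ev_solves X V (fun x => x = 0) gen s' p.
- move=> y; rewrite /p; case: pselect => // _; by exists (Czero X).
- exists g => y; rewrite mem_filter => /andP[/asboolP Py _].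
  by rewrite /p; case: pselect => // _; rewrite subrr.
exists w; split=> // y ys Py.
have : y \in s' by rewrite mem_filter ys andbT; exact/asboolP.
move=> /wE; rewrite /p; case: pselect => // _ /eqP.
by rewrite subr_eq0 => /eqP.
Qed.

End Purity.
Arguments ev {A} G {X V} Q gen c.
Arguments Czero {A G X}.
Arguments Clin {A G X}.
Arguments Csol {A G X}.

(* Smallness is expressed without cardinals: a small module is the set of values
   of codes taken from a type that depends on M (and A, G) only. *)
Section SmallQuotients.
Variables (A : pzRingType) (G : lmodType A) (pG : projective G).
Variable M : lmodType A.

(** One generator suffices: for any [v] in any [V], the closure of [v] under the codes is the image
    of this module, which does not depend on [V]. *)
Definition small_free : lmodType A := freemod A {classic code G unit}.
Local Notation F := small_free.

(* [Qnode h r m y] names the value at y of a chosen e : F -> V lying over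
   m : F -> M and equal on r to the elements named by h. *)
Inductive qcode : Type :=
| Qzero
| Qnode of (F -> qcode) & (F -> Prop) & (F -> M) & F.

Section Eval.
Variables (V : lmodType A) (f : {linear V -> M}).

Definition realizes (q : F -> V) (r : F -> Prop) (m : F -> M)
    (e : {linear F -> V}) :=
  (forall y, r y -> e y = q y) /\ forall y, f (e y) = m y.

Fixpoint qev (c : qcode) : V :=
  match c with
  | Qzero => 0
  | Qnode h r m y => pick_linear (realizes (fun z => qev (h z)) r m) y
  end.

(* The set Q of values of [qev] contains, with any small submodule W of V, a
   copy of W over M that agrees with W on its intersection with Q.  If v were
   outside Q, take for W = e0(F) a submodule containing v and closed under
   solving systems modulo Q, and let e1 be its copy in Q; then the image of
   e0 - e1 would be a nonzero pure submodule of V below ker f. *)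
Lemma qev_surj :
  (forall P : V -> Prop, submodule P -> is_pure G P ->
    (forall x, P x -> f x = 0) -> forall x, P x -> x = 0) ->
  surj qev.
Proof.
move=> nopure v; pose Q x := exists c, qev c = x.
pose e0 : {linear F -> V} :=
  fsum (ev G Q (fun _ : unit => v) : {classic code G unit} -> V).
have e0E y : (exists u, e0 u = y) <-> exists c, ev G Q (fun _ : unit => v) c = y.
  exact: (@fsum_range A V {classic code G unit} _ (ev_submodule G Q (fun=> v)) y).
pose h y := if pselect (Q (e0 y)) is left hy then projT1 (cid hy) else Qzero.
have hE y : Q (e0 y) -> qev (h y) = e0 y.
  by rewrite /h; case: pselect => // hy _; case: cid.
pose t := realizes (fun z => qev (h z)) (fun y => Q (e0 y)) (fun y => f (e0 y)).
pose e1 := pick_linear t.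
have [e1Q fe1] : t e1.
  by apply: pick_linearP; exists e0; split=> // y /hE.
have Qe1 y : Q (e1 y).
  by exists (Qnode h (fun y => Q (e0 y)) (fun y => f (e0 y)) y).
pose D : {linear F -> V} := e0 \- e1.
have D0 y : D y = 0.
  apply: (nopure (fun x => exists y, D y = x)); last by exists y.
  - exact: range_submodule.
  - move=> g s.
    pose Y c := if pselect (exists y, D y = g c) is left hy then projT1 (cid hy)
                else 0.
    pose s' := [seq c <- s | `[< exists y, D y = g c >]].
    have YE c : c \in s' -> D (Y c) = g c.
      rewrite mem_filter => /andP[/asboolP hc _].
      by rewrite /Y; case: pselect => // hy; case: cid.
    (* [g] solves this system modulo [Q], since [e0 (Y c) - g c = e1 (Y c)]. A solution [w] within
       the range of [e0] lifts to [u]; as [e0 (Y c - u c)] lies in [Q], where [e1] agrees with [e0],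
       [D] kills [Y c - u c]. *)
    have [||w [wE wP]] := @ev_solves A G unit V Q (fun=> v) s' (e0 \o Y).
    - by move=> c; apply/e0E; exists (Y c).
    - by exists g => c /YE <-; rewrite /= /D /= subKr.
    have [|u uE] := @projective_lift _ _ _ _ e0 w pG.
      by move=> c; apply/e0E/wP.
    exists (D \o u); split=> [c|c cs Dc]; first by exists (u c).
    have cs' : c \in s' by rewrite mem_filter cs andbT; exact/asboolP.
    have := wE c cs'; rewrite /= -uE -linearB => hQ.
    have : D (Y c - u c) = 0 by rewrite /D /= (e1Q _ hQ) hE // subrr.
    by move/eqP; rewrite linearB subr_eq0 (YE c cs') => /eqP.
  - by move=> _ [x <-]; rewrite /D /= linearB fe1 subrr.
have [y yE] : exists u, e0 u = v by apply/e0E; exists (Cgen G tt).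
have := D0 y; rewrite /D /= yE => /eqP; rewrite subr_eq0 => /eqP ->.
exact: Qe1.
Qed.
End Eval.

Lemma maximal_pure (V : lmodType A) (f : {linear V -> M}) :
  exists P : V -> Prop, [/\ submodule P, is_pure G P, forall x, P x -> f x = 0 &
    forall P' : V -> Prop, submodule P' -> is_pure G P' ->
      (forall x, P' x -> f x = 0) -> (forall x, P x -> P' x) ->
      forall x, P' x -> P x].
Proof.
pose good (P : set V) := [/\ submodule P, is_pure G P & forall x, P x -> f x = 0].
have [|P [Pg Pmax]] := @Zorn_bigcup V (fun P => P = set0 \/ good P).
  move=> C Cg Ctot.
  have [[X0 [CX0 X0g]]|noX] := pselect (exists X, C X /\ good X); last first.
    left; rewrite -subset0 => x [X CX Xx].
    case: (Cg X CX) => [X0|Xg]; first by rewrite X0 in Xx.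
    by apply: noX; exists X.
  have good_of X x : C X -> X x -> good X.
    by move=> CX Xx; case: (Cg X CX) => // X0'; rewrite X0' in Xx.
  right; split.
  - split=> [|a x y [X CX Xx] [Y CY Yy]].
      by exists X0 => //; case: X0g => [[]].
    have [XY|YX] := Ctot X Y CX CY.
      exists Y => //; have [[_ YL] _ _] := good_of Y y CY Yy.
      by apply: YL => //; exact: XY.
    exists X => //; have [[_ XL] _ _] := good_of X x CX Xx.
    by apply: XL => //; exact: YX.
  - move=> g s.
    (* Finitely many right-hand sides are involved, so a single member of the chain contains all
       those lying in the union. *)
    have [X [CX Xg Xs]] : exists X, [/\ C X, good X & forall y, y \in s ->
        (\bigcup_(X in C) X)%classic (g y) -> X (g y)].
      elim: s => [|y s [X [CX Xg Xs]]]; first by exists X0.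
      have [[Y CY Yy]|ny] := pselect ((\bigcup_(X in C) X)%classic (g y)); last first.
        by exists X; split=> // z; rewrite inE => /predU1P[->|/Xs].
      have Yg := good_of Y _ CY Yy.
      have [XY|YX] := Ctot X Y CX CY.
        exists Y; split=> // z; rewrite inE => /predU1P[->|zs] // hz.
        by apply: XY; exact: Xs.
      exists X; split=> // z; rewrite inE => /predU1P[->|zs] // hz.
        exact: YX.
      exact: Xs.
    have [_ Xp _] := Xg; have [g' [g'X g'E]] := Xp g s.
    exists g'; split=> [y|y ys hy]; first by exists X.
    by apply: g'E => //; exact: Xs.
  - move=> x [X CX Xx]; have [_ _ Xf] := good_of X x CX Xx; exact: Xf.
have {Pg} [Psub Ppure Pf] : good P.
  case: Pg => // P0.
  exfalso; apply: (Pmax (fun x => x = 0)).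
    by rewrite P0; split=> [x []|/(_ 0 erefl)].
  right; split; [exact: zero_submodule | exact: pure_zero |].
  by move=> x ->; rewrite linear0.
exists P; split=> // P' P'sub P'pure P'f PP' x P'x.
apply: contrapT => nPx; apply: (Pmax P'); last by right.
by split=> // P'P; apply: nPx; exact: P'P.
Qed.

(** Divide by a maximal pure submodule [P] below the kernel of [f]: a pure submodule of the quotient
    killed by [f'] has a pure preimage, which is [P] by maximality, so [qev_surj] applies. *)
Lemma small_pure_quotient (V : lmodType A) (f : {linear V -> M}) :
  exists (C : lmodType A) (q : {linear V -> C}) (f' : {linear C -> M})
    (b : qcode -> C),
  [/\ surj q, is_pure G (fun x => q x = 0), forall x, f' (q x) = f x & surj b].
Proof.
have [P [Psub Ppure Pf Pmax]] := maximal_pure f.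
have [C [q [sq qE]]] := submodule_quotient Psub.
have [|f' f'E] := @factor_surj _ _ _ _ q f sq; first by move=> x /qE/Pf.
have qpure : is_pure G (fun x => q x = 0).
  by apply: pure_eq Ppure => x; split=> /qE.
exists C, q, f', (qev f'); split=> //.
apply: qev_surj => P' P'sub P'pure P'f y P'y.
have [x xE] := sq y; rewrite -xE; apply/qE.
apply: (Pmax (fun x => P' (q x))); last by rewrite xE.
- exact: preim_submodule.
- exact: pure_preim.
- by move=> z /P'f; rewrite f'E.
- by move=> z /qE ->; case: P'sub.
Qed.

End SmallQuotients.

(** * Precovers and preenvelopes *)

Section Approximations.
Variables (A : pzRingType) (G : lmodType A) (X : mclass A).

Lemma precovering_pure_quotients : projective G ->
  (forall (V C : lmodType A) (q : {linear V -> C}),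
    surj q -> is_pure G (fun x => q x = 0) -> X V -> X C) ->
  (forall (J : choiceType) (Y : J -> lmodType A),
    (forall j, X (Y j)) -> X (dsum Y)) ->
  precovering X.
Proof.
move=> pG Xquo Xsum M; pose B : lmodType A := freemod A {classic qcode G M}.
(* A small module over [M] is encoded as a submodule of [B] together with a map from [B] to [M] that
   kills it. *)
pose obj (p : {U : {pred B} | submod_closed U} * {linear B -> M}) : lmodType A :=
  quomod (proj2_sig p.1).
pose ok p := X (obj p) /\ forall x, x \in proj1_sig p.1 -> p.2 x = 0.
pose J : choiceType := {classic {p | ok p}}.
pose Y (j : J) := obj (proj1_sig j).
have fE (j : J) : exists f : {linear Y j -> M},
    forall x, f (quo_proj (proj2_sig (proj1_sig j).1) x) = (proj1_sig j).2 x.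
  apply: factor_surj; first exact: quo_proj_surj.
  by move=> x /quo_proj_eq0; exact: (proj2_sig j).2.
have [f fdsum] := dsum_universal (fun j : J => projT1 (cid (fE j))).
exists (dsum Y), f; split=> [|Y' h XY'].
  by apply: Xsum => j; exact: (proj2_sig j).1.
have [C [q [h' [b [sq qpure h'E sb]]]]] := small_pure_quotient pG h.
pose c : {linear B -> C} := fsum (b : {classic qcode G M} -> C).
have sc : surj c.
  move=> y; have [x <-] := sb y; exists (delta A (x : {classic _})).
  exact: (@fsum_delta A {classic qcode G M}).
have subc : submod_closed (ker_pred c) := ker_pred_submod c.
have quoE x : quo_proj subc x = 0 <-> c x = 0.
  by rewrite quo_proj_eq0; split=> /eqP.
have [|t tE] := @factor_surj _ _ _ _ c (quo_proj subc) sc.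
  by move=> x /quoE.
have tq0 x : t (q x) = 0 <-> q x = 0.
  by have [y <-] := sc (q x); rewrite tE.
pose p : {U : {pred B} | submod_closed U} * {linear B -> M} :=
  (exist _ (ker_pred c) subc, h' \o c : {linear B -> M}).
have okp : ok p.
  split=> [|x /eqP cx]; last by rewrite /= cx linear0.
  (* [X] passes from [Y'] to the encoded copy of [C] in one step, as [t \o q] has the same pure
     kernel as [q]. *)
  apply: (Xquo Y' (obj p) (t \o q)) => //.
    move=> y; have [x <-] := quo_proj_surj y; have [z zE] := sq (c x).
    by exists z; rewrite /= zE tE.
  by apply: pure_eq qpure => x; rewrite /= tq0.
pose j : J := exist _ p okp.
exists (dsum_inj Y j \o t \o q) => y.
rewrite /= fdsum; case: cid => fj /= fjE; have [x xE] := sc (q y).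
by rewrite -h'E -xE tE fjE.
Qed.

Lemma preenveloping_pure_subs :
  (forall (V K : lmodType A) (i : {linear K -> V}),
    injective i -> is_pure G (fun x => exists y, i y = x) -> X V -> X K) ->
  closed_products X -> preenveloping X.
Proof.
move=> Xsub Xprod M; pose B : lmodType A := freemod A {classic code G M}.
pose obj (U : {U : {pred B} | submod_closed U}) : lmodType A :=
  quomod (proj2_sig U).
pose J := {p : {U & {linear M -> obj U}} | X (obj (projT1 p))}.
pose Y (j : J) := obj (projT1 (proj1_sig j)).
pose f0 (x : M) : dprod Y := fun j => projT2 (proj1_sig j) x.
have f0L : linear f0.
  by move=> a x y; apply: functional_extensionality_dep => j; exact: linearP.
exists (dprod Y), (Lin f0L); split=> [|Y' h XY'].
  by apply: Xprod => j; exact: (proj2_sig j).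
(* The codes with generators the values of [h] name a pure submodule of [Y'] containing the image of
   [h]; it is isomorphic to [B] modulo the kernel of [c]. *)
pose e := ev G (fun x => x = 0) h.
pose c : {linear B -> Y'} := fsum (e : {classic code G M} -> Y').
have cE y : (exists x, c x = y) <-> exists k, e k = y.
  exact: (@fsum_range A Y' {classic code G M} _ (ev_submodule G (fun x => x = 0) h) y).
have subc : submod_closed (ker_pred c) := ker_pred_submod c.
have quoE x : quo_proj subc x = 0 <-> c x = 0.
  by rewrite quo_proj_eq0; split=> /eqP.
have [|i iE] := @factor_surj _ _ _ _ (quo_proj subc) c (@quo_proj_surj _ _ _ subc).
  by move=> x /quoE.
have ii : injective i.
  move=> x y; have [u <-] := quo_proj_surj x; have [v <-] := quo_proj_surj y.
  rewrite !iE => /eqP; rewrite -subr_eq0 -linearB => /eqP /quoE /eqP.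
  by rewrite linearB subr_eq0 => /eqP.
have iR y : (exists x, i x = y) <-> exists k, e k = y.
  rewrite -cE; split=> [[x <-]|[x <-]]; last by exists (quo_proj subc x).
  by have [u <-] := quo_proj_surj x; exists u; rewrite iE.
have [|g gE] := @factor_inj _ _ _ _ i h ii.
  by move=> x; apply/iR; exists (Cgen G x).
pose U : {U : {pred B} | submod_closed U} := exist _ (ker_pred c) subc.
have XU : X (obj U).
  have epure : is_pure G (fun y => exists k, e k = y) by exact: ev_pure.
  apply: (Xsub Y' (obj U) i ii _ XY').
  by apply: pure_eq epure => y; apply: iff_sym; exact: iR.
pose j : J := exist _ (existT _ U g) XU.
pose i' : {linear Y j -> Y'} := i.
by exists (i' \o @dproj A J Y j) => x; rewrite -gE.
Qed.

End Approximations.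

(** * From solvability of equations to injectivity of tensor maps *)

Section PureTensor.
Variable R : pzRingType.

(** With N = F/L and F free, lift [z] to [z'] in K ⊗ F. Its image in V ⊗ F comes from some Σ w_k ⊗
    l_k in V ⊗ L; coordinatewise this is a finite linear system in the w_k with right-hand sides
    from K. A solution in K shows that [z'] comes from K ⊗ L. *)
Lemma pure_tensl_inj (K V : rmod R) (i : {linear K -> V}) (N : lmod R) :
  injective i -> is_pure (freemod R^c nat) (fun x => exists y, i y = x) ->
  tensl_inj i N.
Proof.
move=> ii ipure z iz.
have [ij ejq sq] := free_short_exact N.
set j := ker_incl _ in ij ejq; set q := fsum _ in ejq sq.
have eqV := tensmapr_exact (M := V) sq ejq.
have eqK := tensmapr_exact (M := K) sq ejq.
have [z' z'E] := tensmapr_surj (M := K) sq z.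
have /eqV[y yE] : tensmapr q (tensmap i z') = 0 by rewrite -tensmapC z'E.
have [l lE] := tens_spanned y.
pose w k := (nth (0, 0) l k).1; pose r k := j (nth (0, 0) l k).2.
(* The generators [D k] are the unknowns, and [e x] is the left-hand side of the equation for the
   coordinate [x]. *)
pose D : nat -> freemod R^c nat := @delta R^c nat.
pose e x : freemod R^c nat := \sum_(k < size l) (coef (r k) x : R^c) *: D k.
have [t ht] : exists t : seq N, forall x, x \notin t -> e x = 0.
  exists (flatten [seq supp (r k) | k <- iota 0 (size l)]) => x xt.
  rewrite /e big1 // => k _; rewrite [coef _ _](_ : _ = 0) ?scale0r //.
  apply/eqP; apply: contraNT xt => rx; apply/flatten_mapP; exists (val k).
    by rewrite mem_iota /=.
  by rewrite /supp; case: cid => s [/= _ hs]; exact: hs.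
pose g : {linear freemod R^c nat -> V} := fsum w.
(* The entry 0 accounts for the coordinates outside [t], where [e x] vanishes. *)
have [g' [g'i g'E]] := ipure g (0 :: [seq e x | x <- t]).
have fsumeE (h : {linear freemod R^c nat -> V}) x :
    h (e x) = \sum_(k < size l) (coef (r k) x : R^c) *: h (D k).
  by rewrite linear_sum; apply: eq_bigr => k _; rewrite linearZ.
have coordE (v : nat -> V) x :
    coordl V x (tensmapr j (\sum_(k < size l) tens (v k) (nth (0, 0) l k).2)) =
    \sum_(k < size l) (coef (r k) x : R^c) *: v k.
  rewrite !raddf_sum; apply: eq_bigr => k _.
  by rewrite /= tensmapr_tens coordl_tens.
have gE x : g (e x) = i (coordl K x z').
  rewrite -coordl_tensmap -yE lE (big_nth (0, 0)) big_mkord (coordE w) fsumeE.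
  by apply: eq_bigr => k _; congr (_ *: _); exact: fsum_delta.
have g'gE x : g' (e x) = g (e x).
  apply: g'E; last by exists (coordl K x z').
  have [xt|/ht ->] := boolP (x \in t); last exact: mem_head.
  by rewrite inE map_f ?orbT.
pose v k := projT1 (cid (g'i (D k))).
have vE k : i (v k) = g' (D k) by rewrite /v; case: cid.
pose y' : tensor K _ := \sum_(k < size l) tens (v k) (nth (0, 0) l k).2.
suff : tensmapr j y' = z'.
  by move=> y'E; rewrite -z'E; apply/eqK; exists y'.
apply/eqP; rewrite -subr_eq0; apply/eqP; apply: coordl_eq0 => x.
apply: ii; rewrite (raddfB (coordl K x)) linearB linear0 -gE -g'gE.
rewrite -coordl_tensmap tensmapC raddf_sum.
under eq_bigr => k _ do rewrite /= tensmap_tens vE.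
by rewrite (coordE (fun k => g' (D k))) fsumeE subrr.
Qed.

End PureTensor.

Lemma dprod_short_exact (A : pzRingType) (I : Type) (K P M : I -> lmodType A)
    (i : forall j, {linear K j -> P j}) (p : forall j, {linear P j -> M j}) :
  (forall j, short_exact (i j) (p j)) ->
  exists (i' : {linear dprod K -> dprod P}) (p' : {linear dprod P -> dprod M}),
    short_exact i' p'.
Proof.
move=> ip; have ext := @functional_extensionality_dep I.
have iL : linear (fun x : dprod K => (fun j => i j (x j)) : dprod P).
  by move=> a x y; apply: ext => j; exact: linearP.
have pL : linear (fun x : dprod P => (fun j => p j (x j)) : dprod M).
  by move=> a x y; apply: ext => j; exact: linearP.
exists (Lin iL), (Lin pL); split=> [x y xy|y|y].
- apply: ext => j; have [ij _ _] := ip j; apply: ij.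
  exact: (congr1 (fun f => f j) xy).
- split=> [py|[x <-]]; last first.
    by apply: ext => j; have [_ e _] := ip j; apply/e; exists (x j).
  have ex j : exists x, i j x = y j.
    by have [_ e _] := ip j; apply/e; exact: (congr1 (fun f => f j) py).
  by exists (fun j => projT1 (cid (ex j))); apply: ext => j; rewrite LinE; case: cid.
- have ex j : exists x, p j x = y j by have [_ _ s] := ip j; exact: s.
  by exists (fun j => projT1 (cid (ex j))); apply: ext => j; rewrite LinE; case: cid.
Qed.

(** * Mittag-Leffler modules and closure under products *)

Section MittagLeffler.
Variable R : pzRingType.

Lemma ML_map_injP (I : Type) (Ti : I -> rmod R) (M : lmod R) :
  injective (@ML_map R I Ti M) <->
  forall z : tensor (dprod Ti) M, (forall i, tensmap (@dproj _ _ Ti i) z = 0) ->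
    z = 0.
Proof.
split=> [inj z z0|inj x y xy].
  by apply: inj; apply: functional_extensionality_dep => i; rewrite /ML_map z0 raddf0.
apply/eqP; rewrite -subr_eq0; apply/eqP/inj => i.
by rewrite raddfB; apply/eqP; rewrite subr_eq0; apply/eqP/(congr1 (fun f => f i) xy).
Qed.

(** After embedding [P] as a retract of a free module, the coordinates lie in the product of the
    [Ti] and are determined by their components. *)
Lemma projective_ML (I : Type) (Ti : I -> rmod R) (P : lmod R) : projective P ->
  injective (@ML_map R I Ti P).
Proof.
move=> /projective_retract[s sK]; apply/ML_map_injP => z z0.
have sz0 : tensmapr s z = 0.
  apply: coordl_eq0 => x; apply: functional_extensionality_dep => i.
  have := coordl_tensmap (@dproj _ _ Ti i) x (tensmapr s z).
  by rewrite tensmapC z0 !raddf0.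
rewrite -[z](@tensmapr_id _ _ _ (fsum id \o s)) //.
by rewrite -(@tensmapr_comp _ _ _ _ _ s (fsum id)) // sz0 raddf0.
Qed.

Lemma ML_dim1_products (T : mclass R^c) (S : mclass R) : tor_pair T S ->
  (forall N, S N -> rel_dim (ML T) 1 N) <-> closed_products T.
Proof.
case=> TS _; split=> [hML I Ti TTi|hT N SN].
  apply/TS => N SN; have [P PML] := hML N SN.
  have se := ker_short_exact (@res_surj _ _ P).
  have pP := @res_projective _ _ P 0.
  apply/(Tor1_zeroEr _ se pP) => z hz.
  have /ML_map_injP := PML I Ti TTi; apply => i.
  have /TS/(_ N SN)/(Tor1_zeroEr _ se pP) := TTi i; apply.
  by rewrite -tensmapC hz raddf0.
(* Any resolution works: tensoring its syzygy inclusion with the product, which lies in [T], is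
   injective, and the target embeds in the product of the Ti ⊗ P_0. *)
have [P] := proj_resolution_exists N; exists P => I Ti TTi.
have se := ker_short_exact (@res_surj _ _ P).
have pP := @res_projective _ _ P 0.
apply/ML_map_injP => z hz.
have /TS/(_ N SN)/(Tor1_zeroEr _ se pP) := hT I Ti TTi; apply.
have /ML_map_injP := projective_ML (Ti := Ti) pP; apply => i.
by rewrite tensmapC hz raddf0.
Qed.

End MittagLeffler.

(** * Closure properties of the classes T_k *)

Section RelativeDimension.
Variables (R : pzRingType) (T : mclass R^c) (S : mclass R).
Hypothesis TS : tor_pair T S.

Lemma rel_dim_direct_limits k : closed_direct_limits (rel_dim T k).
Proof.
move=> d I D L l lim TD; apply/(rel_dim_Tor1 _ _ TS) => N SN.
apply: (Tor1_direct_limit lim) => i.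
by have /(rel_dim_Tor1 _ _ TS) := TD i; exact.
Qed.

Lemma rel_dim_pure_submodules k : closed_pure_submodules (rel_dim T k).
Proof.
move=> K M i [_ ipure] /(rel_dim_Tor1 _ _ TS) TM.
apply/(rel_dim_Tor1 _ _ TS) => N SN; apply: (Tor1_pure_sub (i := i) _ (TM N SN)).
by move=> L z iz; apply: ipure; rewrite iz raddf0.
Qed.

Lemma rel_dim_precovering k : precovering (rel_dim T k).
Proof.
apply: (@precovering_pure_quotients _ (freemod R^c nat)).
- exact: freemod_projective.
- move=> V C q sq qpure /(rel_dim_Tor1 _ _ TS) TV.
  apply/(rel_dim_Tor1 _ _ TS) => N SN.
  apply: (Tor1_pure_quotient (ker_short_exact sq) _ (TV N SN)).
  apply: pure_tensl_inj; first exact: val_inj.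
  by apply: pure_eq qpure => x; exact: ker_exact.
- move=> J Y TY; apply/(rel_dim_Tor1 _ _ TS) => N SN; apply: Tor1_dsum => j.
  by have /(rel_dim_Tor1 _ _ TS) := TY j; exact.
Qed.

(** A resolving class contains the free syzygies of its members, so each syzygy of [N] can be traded
    for one of [M] without leaving [T]. *)
Lemma resolving_rel_dim k (M : rmod R) : resolving T -> T M -> rel_dim T k M.
Proof.
move=> [Tproj _ Tker] TM; elim: k M TM => [//|k IH] M TM.
apply/(rel_dim_Tor1 _ _ TS) => N SN.
have fM := free_short_exact M.
have pM := freemod_projective (A := R^c) (X := M).
apply/(Tor1_shift fM (free_short_exact (free_syz N k)) pM).
  exact: freemod_projective.
have /IH/(rel_dim_Tor1 _ _ TS) := Tker _ _ _ _ _ fM (Tproj _ pM) TM.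
exact.
Qed.

(** In the inductive step the product of the syzygies lies in T_k and the middle term of the product
    presentation in [T]; [Tor1_cokernel] then puts the cokernel in T_{k+1}. *)
Lemma rel_dim_products k : resolving T -> closed_products T ->
  closed_products (rel_dim T k).
Proof.
move=> Tres Tprod; elim: k => [|k IH] I M TM; first exact: Tprod.
have [Tproj _ _] := Tres.
have [i [p ip]] := @dprod_short_exact _ I _ _ _ _ _
  (fun j => free_short_exact (M j)).
have TP : T (dprod (fun j => freemod R^c (M j))).
  by apply: Tprod => j; apply: Tproj; exact: freemod_projective.
have TK j : rel_dim T k (kermod (@fsum R^c (M j) (M j) id)).
  apply/(rel_dim_Tor1 _ _ TS) => N SN.
  have pM := freemod_projective (A := R^c) (X := M j).
  apply/(Tor1_shift (free_short_exact (M j)) (free_short_exact (free_syz N k)) pM).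
    exact: freemod_projective.
  by have /(rel_dim_Tor1 _ _ TS) := TM j; exact.
apply/(rel_dim_Tor1 _ _ TS) => N SN.
apply: (Tor1_cokernel (N := free_syz N k) ip).
  by have /(rel_dim_Tor1 _ _ TS) := IH I _ TK; exact.
by have /(rel_dim_Tor1 _ _ TS) := resolving_rel_dim k.+1 Tres TP; exact.
Qed.

Lemma rel_dim_preenveloping k :
  closed_products (rel_dim T k) -> preenveloping (rel_dim T k).
Proof.
move=> Tprod; apply: (@preenveloping_pure_subs _ (freemod R^c nat)) => //.
move=> V K i ii ipure; apply: (rel_dim_pure_submodules (f := i)); split=> // L.
by apply: raddf_inj => z; exact: pure_tensl_inj.
Qed.

End RelativeDimension.

Theorem corollary3p11 (R : pzRingType) (T : mclass R^c) (S : mclass R)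
    (TS : tor_pair T S) (m : nat) :
  precovering (rel_dim T m) /\
  (hereditary T S ->
    let a := forall N, S N -> rel_dim (ML T) 1 N in
    let b := closed_products T in
    let c := forall k : nat, definable (rel_dim T k) in
    ((a <-> b) /\ (b <-> c)) /\
    (a \/ b \/ c -> preenveloping (rel_dim T m))).
Proof.
split=> [|her a b c]; first exact: (rel_dim_precovering TS).
have ab : a <-> b := ML_dim1_products TS.
have bc : b <-> c.
  (* Conversely, (c) at k = 0 contains (b), since [rel_dim T 0] is [T]. *)
  split=> [hb k|/(_ 0%N)[]//]; split.
  - exact: (rel_dim_products TS).
  - exact: (rel_dim_direct_limits TS).
  - exact: (rel_dim_pure_submodules TS).
split=> // abc.
have hc : c by case: abc => [/ab/bc|[/bc|]].
by have [hprod _ _] := hc m; exact: (rel_dim_preenveloping TS).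
Qed.
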